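(* Let $\epsilon,\delta>0$, let $k$ be a positive integer, and let $S\in\mathcal{U}^{\mathbb{N}}$ be a finite stream over the universe $\mathcal{U}=[d]$. Then the mechanism $\mathrm{PMG}(k,S)$ satisfies $(\epsilon,\delta)$-differential privacy. Let $f(x)$ denote the number of occurrences of $x\in\mathcal{U}$ in $S$ and let $\hat f(x)$ denote the estimated frequency of $x$ from the output of $\mathrm{PMG}(k,S)$. For every $x$ with $f(x)=0$ we have $\hat f(x)=0$. For every $\beta\in(0,1)$, with probability at least $1-\beta$ we have for all $x\in\mathcal{U}$ that $$\hat f(x)\in\Big[f(x)-\frac{2\ln\left(\frac{k+1}{\beta}\right)}{\epsilon}-1-\frac{2\ln(3/\delta)}{\epsilon}-\frac{|S|}{k+1},\; f(x)+\frac{2\ln\left(\frac{k+1}{\beta}\right)}{\epsilon}\Big].$$ Moreover, the algorithm outputs all $x$ such that $\hat f(x)>0$, and there are at most $k$ such elements. For any fixed $x\in\mathcal{U}$ the mean squared error satisfies $$\mathbb{E}[(\hat f(x)-f(x))^2]\le 3\left(1+\frac{2+2\ln(3/\delta)}{\epsilon}+\frac{|S|}{k+1}\right)^2 .$$ Finally, $\mathrm{PMG}(k,S)$ uses $2k$ words of memory.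
   Context: Universe $\mathcal{U}=[d]=\{1,\dots,d\}$. Two finite streams $S,S'$ are neighboring ($S\sim S'$) if one is obtained from the other by deleting exactly one element (at some position). A randomized mechanism $\mathcal{M}$ on streams is $(\epsilon,\delta)$-differentially private if for all neighboring $S\sim S'$ and all measurable sets $Z$ of outputs, $\Pr[\mathcal{M}(S)\in Z]\le e^\epsilon\Pr[\mathcal{M}(S')\in Z]+\delta$. $\mathrm{Lap}(b)$ denotes the Laplace distribution centered at $0$ with density $\frac{1}{2b}e^{-|x|/b}$. Algorithm $\mathrm{MG}(k,S)$ (Misra–Gries variant): initialize the key set $T=\{d+1,\dots,d+k\}$ (dummy keys outside $\mathcal{U}$) with counters $c_i=0$ for $i\in T$. For each element $x$ of $S$ in order: (Branch 1) if $x\in T$, set $c_x\leftarrow c_x+1$; (Branch 2) else if $c_i\ge 1$ for all $i\in T$, set $c_i\leftarrow c_i-1$ for all $i\in T$; (Branch 3) otherwise let $y$ be the smallest key in $T$ with $c_y=0$, set $T\leftarrow (T\cup\{x\})\setminus\{y\}$ and $c_x\leftarrow 1$. Return $(T,c)$. Counters of keys not in $T$ are implicitly $0$. Algorithm $\mathrm{PMG}(T,c)$ with parameters $\epsilon,\delta>0$: set $\tilde T=\emptyset$; sample one $\eta\sim\mathrm{Lap}(1/\epsilon)$; for each $x\in T$, set $c_x\leftarrow c_x+\eta+L_x$ where $L_x\sim\mathrm{Lap}(1/\epsilon)$ are independent fresh samples, and if $c_x\ge 1+2\ln(3/\delta)/\epsilon$ add $x$ to $\tilde T$ with $\tilde c_x=c_x$.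 Return $(\tilde T,\tilde c)$. $\mathrm{PMG}(k,S)$ denotes $\mathrm{PMG}(\mathrm{MG}(k,S))$. The estimated frequency is $\hat f(x)=\tilde c_x$ if $x\in\tilde T$ and $\hat f(x)=0$ otherwise.
   Formalization: The high-probability interval and the mean squared error bound are proved for δ ≤ 1 only, since for large δ they fail (the interval becomes empty); privacy and all other claims are proved for every δ > 0. Memory counts the stored keys and counters, one word each. *)

(* Defs.v *)
From mathcomp Require Import all_boot all_order all_algebra.
From mathcomp Require Import all_classical all_reals all_analysis.

Set Implicit Arguments.
Unset Strict Implicit.
Unset Printing Implicit Defensive.

Import Order.TTheory GRing.Theory Num.Theory.

(* Keys are numbered from 0: the universe [d] is 'I_d, embedded in the key     *)
(* type 'I_(d + k) by [lshift k], and the k dummy keys are the elements        *)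
(* [rshift d j], all larger than every element of the universe.                *)

(* A pair (T, c); only the counters c x with x \in T are stored, the others    *)
(* are kept at 0.                                                              *)
Definition sketch (d k : nat) (V : Type) : Type :=
  ({set 'I_(d + k)} * {ffun 'I_(d + k) -> V})%type.

Section MisraGries.
Variables d k : nat.
Local Notation key := ('I_(d + k)).
Local Open Scope nat_scope.

Definition mg_init : sketch d k nat :=
  ([set rshift d j | j : 'I_k]%SET, [ffun=> 0]).

Definition smallest_zero_key (T : {set key}) (c : {ffun key -> nat}) :
    option key :=
  [pick y in T | (c y == 0) && [forall z in T, (c z == 0) ==> (y <= z)]].

Definition mg_step (s : sketch d k nat) (u : 'I_d) : sketch d k nat :=
  let: (T, c) := s in
  let x := lshift k u in
  if x \in T then (T, [ffun i => if i == x then (c i).+1 else c i])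
  else if [forall i in T, 1 <= c i] then
    (T, [ffun i => if i \in T then (c i).-1 else c i])
  else if smallest_zero_key T c is Some y then
    (((x |: T) :\ y)%SET, [ffun i => if i == x then 1 else c i])
  else s (* unreachable *).

Definition mg (S : seq 'I_d) : sketch d k nat := foldl mg_step mg_init S.

Definition mg_trace (S : seq 'I_d) : seq (sketch d k nat) :=
  mg_init :: scanl mg_step mg_init S.

(* Memory image of a sketch: one word per stored key and one per stored        *)
(* counter.                                                                    *)
Definition words (V : Type) (s : sketch d k V) : seq (key + V) :=
  [seq inl x | x <- enum s.1] ++ [seq inr (s.2 x) | x <- enum s.1].

End MisraGries.

Arguments mg_init : clear implicits.
Arguments mg {d} k S.
Arguments mg_trace {d} k S.

Section PrivateMisraGries.
Variables (R : realType) (d k : nat).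
Local Notation key := ('I_(d + k)).
Local Open Scope ring_scope.

Definition threshold (eps delta : R) : R := 1 + 2 * ln (3 / delta) / eps.

Definition add_noise (s : sketch d k nat) (eta : R) (L : key -> R) :
    sketch d k R :=
  (s.1, [ffun x => if x \in s.1 then (s.2 x)%:R + eta + L x else 0]).

(* The counters of discarded keys are erased: the result carries exactly the   *)
(* released pairs (x, c x).                                                    *)
Definition release (eps delta : R) (s : sketch d k R) : sketch d k R :=
  let T' := [set x in s.1 | threshold eps delta <= s.2 x]%SET in
  (T', [ffun x => if x \in T' then s.2 x else 0]).

Definition estimate (o : sketch d k R) (x : 'I_d) : R :=
  if lshift k x \in o.1 then o.2 (lshift k x) else 0.

End PrivateMisraGries.

Section Probability.
Local Open Scope classical_set_scope.
Local Open Scope ring_scope.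

Definition laplace_pdf (R : realType) (b x : R) : R :=
  (2 * b)^-1 * expR (- (`|x| / b)).

Definition laplace_distributed (dsp : measure_display)
    (Omega : measurableType dsp) (R : realType) (P : probability Omega R)
    (b : R) (X : {RV P >-> R}) : Prop :=
  forall A : set R, measurable A ->
    distribution P X A =
    (\int[lebesgue_measure]_(x in A) (laplace_pdf b x)%:E)%E.

(* The product rule for subfamilies is the case B i = setT of the others.      *)
Definition mutually_independent (dsp : measure_display)
    (Omega : measurableType dsp) (R : realType) (P : probability Omega R)
    (I : finType) (X : I -> {RV P >-> R}) : Prop :=
  forall B : I -> set R, (forall i, measurable (B i)) ->
    P (\bigcap_(i in [set: I]) X i @^-1` B i) =
    (\prod_(i : I) P (X i @^-1` B i))%E.

(* eta is the noise shared by all counters, L x the noise of key x.            *)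
Definition laplace_noise (dsp : measure_display)
    (Omega : measurableType dsp) (R : realType) (P : probability Omega R)
    (b : R) (I : finType) (eta : {RV P >-> R}) (L : I -> {RV P >-> R}) : Prop :=
  let N := fun i : option I => if i is Some x then L x else eta in
  (forall i, laplace_distributed b (N i)) /\ mutually_independent N.

Definition pmg (dsp : measure_display) (Omega : measurableType dsp)
    (R : realType) (P : probability Omega R) (d k : nat) (eps delta : R)
    (eta : {RV P >-> R}) (L : 'I_(d + k) -> {RV P >-> R})
    (S : seq 'I_d) (w : Omega) : sketch d k R :=
  release eps delta (add_noise (mg k S) (eta w) (fun x => L x w)).

(* Largest number of words held in any configuration: the Misra-Gries sketch   *)
(* after each prefix of the stream, the noisy sketch and the output.           *)
Definition pmg_memory (dsp : measure_display) (Omega : measurableType dsp)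
    (R : realType) (P : probability Omega R) (d k : nat) (eps delta : R)
    (eta : {RV P >-> R}) (L : 'I_(d + k) -> {RV P >-> R})
    (S : seq 'I_d) (w : Omega) : nat :=
  let noisy := add_noise (mg k S) (eta w) (fun x => L x w) in
  maxn (\max_(s <- mg_trace k S) size (words s))
       (maxn (size (words noisy))
             (size (words (pmg eps delta eta L S w)))).

(* Generators of the sigma-algebra on outputs making x \in T and c x           *)
(* measurable for every key x.                                                 *)
Definition output_generators (R : realType) (d k : nat) :
    set (set (sketch d k R)) :=
  [set Z | exists x : 'I_(d + k),
     Z = [set o : sketch d k R | x \in o.1] \/
     exists2 B : set R, measurable B & Z = [set o : sketch d k R | B (o.2 x)]].

Definition neighboring (U : Type) (S S' : seq U) : Prop :=
  exists (A B : seq U) (x : U),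
    (S = A ++ x :: B /\ S' = A ++ B) \/ (S' = A ++ x :: B /\ S = A ++ B).

Definition differentially_private (dsp : measure_display)
    (Omega : measurableType dsp) (R : realType) (P : probability Omega R)
    (U Out : Type) (G : set (set Out)) (M : seq U -> Omega -> Out)
    (eps delta : R) : Prop :=
  forall S S' : seq U, neighboring S S' ->
  forall Z : set Out, <<s G >> Z ->
    (P (M S @^-1` Z) <= (expR eps)%:E * P (M S' @^-1` Z) + delta%:E)%E.

End Probability.

(* Main.v *)
Require Import Defs.
From HB Require Import structures.
From mathcomp Require Import all_boot all_order all_algebra.
From mathcomp Require Import all_classical all_reals all_analysis.
From mathcomp Require Import measurable_realfun zify ring lra.

(* Run Misra-Gries on a stream and on the stream with one element deleted.
   At every later time either all counters of the second sketch exceed those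
   of the first by one, or a single counter of the first exceeds by one the
   corresponding counter of the second; at most two keys of each sketch are
   missing from the other, and these have counters at most 1.  In the first
   case the outputs agree after moving the shared noise by one, in the second
   after moving one individual noise by one, provided that the shared noise
   and the noises of the (at most four) unshared keys are below
   t = ln (3 / delta) / eps.  Each of these five conditions fails with
   probability delta / 6, and moving one Laplace variable by one changes
   probabilities by a factor at most expR eps.

   The error bounds combine the Misra-Gries error |S| / (k + 1) with tail and
   second moment estimates for the noise.  The second moment of the sum of two
   noises is bounded by twice the sum of the second moments; this loss is
   absorbed by the threshold, which is at least 1 / eps. *)

Set Implicit Arguments.
Unset Strict Implicit.
Unset Printing Implicit Defensive.

Import Order.TTheory GRing.Theory Num.Theory.

(** * Neighbouring Misra-Gries sketches *)

Arguments mg_step : simpl never.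

Section Sketches.
Variables d k : nat.
Local Notation key := ('I_(d + k)).
Local Open Scope nat_scope.
Implicit Types (T : {set key}) (c : {ffun key -> nat}) (u : 'I_d).

Definition incr c (x : key) : {ffun key -> nat} :=
  [ffun i => if i == x then (c i).+1 else c i].
Definition decr T c : {ffun key -> nat} :=
  [ffun i => if i \in T then (c i).-1 else c i].
Definition insert c (x : key) : {ffun key -> nat} :=
  [ffun i => if i == x then 1 else c i].

(** The three branches as a view for case analysis; the fallback of [mg_step] does not occur in
    it. *)
Variant mg_step_spec T c (x : key) : sketch d k nat -> Prop :=
| MgHit of x \in T : mg_step_spec T c x (T, incr c x)
| MgDecr of x \notin T & (forall i, i \in T -> 0 < c i) :
    mg_step_spec T c x (T, decr T c)
| MgSwap y of x \notin T & y \in T & c y = 0 &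
    (forall z, z \in T -> c z = 0 -> y <= z) :
    mg_step_spec T c x (((x |: T) :\ y)%SET, insert c x).

Lemma mg_stepP T c u : mg_step_spec T c (lshift k u) (mg_step (T, c) u).
Proof.
rewrite /mg_step; case: ifPn => xT; first exact: MgHit.
case: ifPn => [/forall_inP cT|]; first exact: MgDecr.
rewrite negb_forall_in => /existsP[z0 /andP[z0T cz0]].
have z0P : (z0 \in T) && (c z0 == 0) by rewrite z0T /=; lia.
rewrite /smallest_zero_key; case: pickP => [y|none].
  case/and3P=> yT /eqP cy /forall_inP ymin.
  apply: MgSwap => // z zT cz; have := ymin z zT.
  by rewrite cz eqxx.
(* The fallback is contradictory: a zero counter exists, and the one with the smallest key satisfies
   the test of [smallest_zero_key]. *)
case: (arg_minnP (P := fun y => (y \in T) && (c y == 0)) val z0P).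
move=> y /andP[yT cy] ymin; have := none y; rewrite /= yT cy /=.
move/negbT; rewrite negb_forall_in => /existsP[z /andP[zT]].
rewrite negb_imply => /andP[cz]; have /= -> // := ymin z _; rewrite zT cz //.
Qed.

(** The fixed cardinality turns inclusion of key sets into equality; the zero clause lets counters
    of two sketches be compared at every key, stored or not. *)
Definition well_formed (s : sketch d k nat) : Prop :=
  #|s.1| = k /\ forall x, x \notin s.1 -> s.2 x = 0.

Lemma mg_rcons (S : seq 'I_d) u : mg k (rcons S u) = mg_step (mg k S) u.
Proof. by rewrite /mg foldl_rcons. Qed.

Lemma card_swap T (x y : key) :
  x \notin T -> y \in T -> #|((x |: T) :\ y)%SET| = #|T|.
Proof.
move=> xT yT; have := cardsD1 y (x |: T)%SET.
by rewrite cardsU1 xT !inE yT orbT /= add1n => -[].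
Qed.

Lemma well_formed_init : well_formed (mg_init d k).
Proof.
split=> [|x _]; last by rewrite ffunE.
by rewrite card_imset ?card_ord//; exact: rshift_inj.
Qed.

Lemma well_formed_step s u : well_formed s -> well_formed (mg_step s u).
Proof.
case: s => T c [/= Tk c0]; case: (mg_stepP T c u) => /=.
- move=> xT; split=> //= x xNT; rewrite ffunE; case: eqP => [xE|_];
    last exact: c0.
  by rewrite xE xT in xNT.
- by move=> _ _; split=> //= x xNT; rewrite ffunE (negPf xNT) c0.
- move=> y xT yT cy _; split=> /= [|x]; first by rewrite card_swap.
  rewrite !inE ffunE; case: (eqVneq x y) => [->|_] /=.
    by case: eqP => // yE; rewrite -yE yT in xT.
  by case: eqP => //= _ /c0.
Qed.

Lemma well_formed_foldl s (S : seq 'I_d) :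
  well_formed s -> well_formed (foldl (@mg_step d k) s S).
Proof. by elim: S s => //= u S IH s /(@well_formed_step _ u); exact: IH. Qed.

Lemma well_formed_mg (S : seq 'I_d) : well_formed (mg k S).
Proof. exact/well_formed_foldl/well_formed_init. Qed.

Lemma mem_mg (S : seq 'I_d) u : lshift k u \in (mg k S).1 -> u \in S.
Proof.
elim/last_ind: S => [|S v IH].
  by move=> /imsetP[j _ /eqP]; rewrite eq_lrshift.
rewrite mg_rcons mem_rcons in_cons; case: (mg k S) IH => T c /= IH.
case: (mg_stepP T c v) => /= [_ /IH ->|_ _ /IH ->|y _ _ _ _]; rewrite ?orbT//.
rewrite !inE => /andP[_ /orP[|/IH ->]]; last by rewrite orbT.
by rewrite eq_lshift => ->.
Qed.

(** The witness [m] is the number of decrementing steps. Such a step consumes one element and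
    removes one from each of [k] counters, so it costs [k.+1] in the balance, and it lowers each
    counter by at most one. *)
Lemma mg_error (S : seq 'I_d) : exists m,
  \sum_(i in (mg k S).1) (mg k S).2 i + k.+1 * m = size S /\
  forall u, (mg k S).2 (lshift k u) <= count_mem u S
            <= (mg k S).2 (lshift k u) + m.
Proof.
elim/last_ind: S => [|S v [m [sumE cE]]].
  by exists 0; split=> [|u]; rewrite ?ffunE// muln0 addn0 big1// => i _;
    rewrite ffunE.
move: (well_formed_mg S) sumE cE; rewrite mg_rcons size_rcons.
case: (mg k S) => T c [/= Tk c0] sumE cE.
have cntE u : count_mem u (rcons S v) = count_mem u S + (u == v).
  by rewrite -cats1 count_cat /= addn0 eq_sym.
case: (mg_stepP T c v) => /= [xT|xT cT|y xT yT cy _].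
- exists m; split=> [|u]; last first.
    rewrite cntE ffunE eq_lshift; have := cE u; case: eqP => _ /=; lia.
  rewrite (bigD1 (lshift k v))//= ffunE eqxx.
  under eq_bigr => i /andP[_ /negPf iv] do rewrite ffunE iv.
  by rewrite -sumE [in RHS](bigD1 (lshift k v))//= !addSn.
- exists m.+1; split=> [|u]; last first.
    rewrite cntE ffunE; have := cE u; case: eqP => [->|_] /=.
      by rewrite (negPf xT) c0//; lia.
    by case: ifPn => [/cT|/c0]; lia.
  have : \sum_(i in T) c i = \sum_(i in T) decr T c i + #|T|.
    rewrite -sum1_card -big_split /=; apply: eq_bigr => i iT.
    by rewrite ffunE iT; have := cT i iT; lia.
  rewrite Tk -sumE => ->; set a := bigop _ _ _; rewrite mulnS; lia.
- exists m; split=> [|u]; last first.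
    rewrite cntE ffunE eq_lshift; have := cE u; case: eqP => [->|_] /=;
      last lia.
    by rewrite c0//; lia.
  have xy : lshift k v != y by apply: contraNneq xT => ->.
  have xin : lshift k v \in ((lshift k v |: T) :\ y)%SET.
    by rewrite !inE xy eqxx.
  (* The replaced key has counter 0, so the sum changes only by the 1 of the new key. *)
  rewrite (bigD1 (lshift k v))//= ffunE eqxx -sumE [in RHS](bigD1 y)//= cy.
  rewrite add0n add1n addSn; congr (_ + _).+1.
  apply: eq_big => [i|i /andP[_ /negPf iv]]; last by rewrite ffunE iv.
  rewrite !inE.
  case: (eqVneq i (lshift k v)) => [->|_] /=; first by rewrite (negPf xT) andbF.
  by rewrite andbT andbC.
Qed.


(* The key sets can lose a further common key only when both sketches replace
   common but different keys.  Then the second one replaces [i], whose counter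
   is 0 there, and the last clause says that the key sets were equal before. *)
Variant mg_adjacent (s s' : sketch d k nat) : Prop :=
| AdjacentAll of
    #|s.1 :\: s'.1| <= 1 &
    (forall j, j \in s'.1 -> s'.2 j = (s.2 j).+1) &
    (forall j, j \notin s'.1 -> s.2 j = 0)
| AdjacentOne i of
    #|s.1 :\: s'.1| <= 2 &
    i \in s.1 &
    s.2 i = (s'.2 i).+1 &
    (forall j, j != i -> s.2 j = s'.2 j) &
    (i \in s'.1 -> s'.2 i = 0 -> s.1 = s'.1).

(** Base case, at the deleted element: a decrement gives [AdjacentAll], the other branches give
    [AdjacentOne] at the key just read. *)
Lemma mg_adjacent_insert s u : well_formed s -> mg_adjacent (mg_step s u) s.
Proof.
case: s => T c [/= Tk c0]; case: (mg_stepP T c u) => [xT|xT cT|y xT yT cy _].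
- apply: (AdjacentOne (i := lshift k u)) => //=;
    first by rewrite finset.setDv cards0.
    by rewrite ffunE eqxx.
  by move=> j /negPf jx; rewrite ffunE jx.
- apply: AdjacentAll => /= [|j jT|j jT]; rewrite ?finset.setDv ?cards0// ffunE.
    by rewrite jT; have := cT j jT; lia.
  by rewrite (negPf jT) c0.
- apply: (AdjacentOne (i := lshift k u)) => /=.
  + rewrite (leq_trans (subset_leq_card
      (_ : _ \subset [set lshift k u]))) ?cards1//.
    by apply/fintype.subsetP => j; rewrite !inE; case: (j \in T);
      rewrite ?orbF ?andbF//= andbC => /andP[].
  + by rewrite !inE eqxx andbT; apply: contraNneq xT => ->.
  + by rewrite ffunE eqxx c0.
  + by move=> j /negPf jx; rewrite ffunE jx.
  + by rewrite (negPf xT).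
Qed.

Lemma leq_cardsU1 (x : key) T : #|(x |: T)%SET| <= #|T|.+1.
Proof. by rewrite cardsU1; case: (_ \notin _). Qed.

Lemma card_setDC T T' : #|T| = #|T'| -> #|T :\: T'| = #|T' :\: T|.
Proof. by rewrite -(cardsID T' T) -(cardsID T T') finset.setIC => /addnI. Qed.

(** The pairs of branches are examined in each case. Under [AdjacentAll] the counters of the second
    sketch are positive, so it cannot replace a key; when it decrements and the first does not, the
    case becomes [AdjacentOne] at the key read. Under [AdjacentOne] the case becomes [AdjacentAll]
    exactly when the first sketch decrements and the second does not. *)
Lemma mg_adjacent_step s s' u : well_formed s -> well_formed s' ->
  mg_adjacent s s' -> mg_adjacent (mg_step s u) (mg_step s' u).
Proof.
case: s s' => T c [T' c'] [/= Tk c0] [/= Tk' c0'].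
have eqT : T \subset T' -> T = T'.
  by move=> sT; apply/eqP; rewrite eqEcard sT Tk Tk' leqnn.
have eqT' : T' \subset T -> T = T'.
  by move=> sT; apply/esym/eqP; rewrite eqEcard sT Tk Tk' leqnn.
have cDC : #|T :\: T'| = #|T' :\: T| by apply: card_setDC; rewrite Tk Tk'.
case=> /= [card1 cT' cN|i card2 iT ci cj iP].
  case: (mg_stepP T' c' u) => [xT'|xT' _|y' xT' yT' cy' _]; last first.
  - by have := cT' y' yT'; rewrite cy'.
  - case: (mg_stepP T c u) => [xT|xT cT|y xT yT cy _].
    + apply: (AdjacentOne (i := lshift k u)) => //=.
      * by rewrite (leq_trans card1).
      * by rewrite !ffunE eqxx (negPf xT') cN// c0'.
      * move=> j /negPf jx; rewrite !ffunE jx.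
        by case: ifPn => [/cT' ->//|jT]; rewrite cN// c0'.
      * by rewrite (negPf xT').
    + have sTT' : T \subset T'.
        by apply/fintype.subsetP => j /cT; apply: contraTT => /cN ->.
      have eTT' := eqT sTT'; apply: AdjacentAll => //= j jT'; rewrite !ffunE.
        by rewrite eTT' jT' cT'//= prednK// cT// eTT'.
      by rewrite eTT' (negPf jT') cN.
    + apply: (AdjacentOne (i := lshift k u)) => /=.
      (* The key read enters the first sketch only, so the difference may grow from one key to
         two. *)
      * apply: (leq_trans (subset_leq_card (_ : _ \subset lshift k u |:
          (T :\: T')))).
          by apply/fintype.subsetP => j; rewrite !inE; do 4?case: (_ == _);
            case: (_ \in T); case: (_ \in T').
        by rewrite (leq_trans (leq_cardsU1 _ _)).
      * by rewrite !inE eqxx andbT; apply: contraNneq xT => ->.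
      * by rewrite !ffunE eqxx (negPf xT') c0'.
      * move=> j /negPf jx; rewrite !ffunE jx.
        by case: ifPn => [/cT' ->//|jT]; rewrite cN// c0'.
      * by rewrite (negPf xT').
  - case: (mg_stepP T c u) => [xT|xT cT|y xT yT cy _].
    + apply: AdjacentAll => //= j jT'; rewrite !ffunE.
        by rewrite cT'//; case: eqP.
      by rewrite cN//; case: eqP => // jx; rewrite jx xT' in jT'.
    + have sTT' : T \subset T'.
        by apply/fintype.subsetP => j /cT; apply: contraTT => /cN ->.
      by rewrite (eqT sTT') xT' in xT.
    + apply: AdjacentAll => /= [|j jT'|j jT']; rewrite ?ffunE.
      * apply: leq_trans card1; apply: subset_leq_card.
        apply/fintype.subsetP => j; rewrite !inE.
        by case: (eqVneq j (lshift k u)) => [->|_];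
          rewrite ?xT'//= => /and3P[-> _ ->].
      * by rewrite cT'//; case: eqP => // ->; rewrite c0.
      * by rewrite cN//; case: eqP => // jx; rewrite jx xT' in jT'.
(* Counters differ only at [i]. Hence if the second sketch decrements, the key sets coincide
   ([posT']); if the first does, only [i] can be missing from the second ([posT]). *)
have sub0 j : 0 < c' j -> j \in T.
  move=> cj0; case: (eqVneq j i) => [->//|ji].
  by move: cj0; apply: contraTT => /c0; rewrite cj// => ->.
have posT' : (forall j, j \in T' -> 0 < c' j) -> T = T'.
  by move=> pos; apply: eqT'; apply/fintype.subsetP => j /pos/sub0.
have posT : (forall j, j \in T -> 0 < c j) -> T :\: T' \subset [set i].
  move=> pos; apply/fintype.subsetP => j; rewrite !inE => /andP[jT' /pos].
  by apply: contraTT => ji; rewrite cj// c0'.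
case: (mg_stepP T c u) => [xT|xT cT|y xT yT cy ymin].
- case: (mg_stepP T' c' u) => [xT'|xT' cT'|y' xT' yT' cy' ymin'].
  + apply: (AdjacentOne (i := i)) => //=.
    * by rewrite !ffunE ci; case: eqP.
    * by move=> j ji; rewrite !ffunE cj.
    * by move=> iT'; rewrite ffunE; case: eqP => // _; exact: iP.
  + by rewrite (posT' cT') (negPf xT') in xT.
  + apply: (AdjacentOne (i := i)) => //=.
    * apply: (leq_trans (subset_leq_card (_ : _ \subset y' |:
        ((T :\: T') :\ lshift k u)))).
        by apply/fintype.subsetP => j; rewrite !inE; do 4?case: (_ == _);
          case: (_ \in T); case: (_ \in T').
      rewrite (leq_trans (leq_cardsU1 _ _))// (leq_trans _ card2)//.
      by rewrite (cardsD1 (lshift k u) (T :\: T')) !inE xT xT'.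
    * by rewrite !ffunE ci; case: eqP => // ->; rewrite c0'.
    * by move=> j ji; rewrite !ffunE cj//; case: eqP => // ->; rewrite c0'.
    * rewrite !inE ffunE; case: (eqVneq i (lshift k u)) => [_ _ //|_] /=.
      by case/andP => _ iT' /(iP iT') TT'; rewrite TT' (negPf xT') in xT.
- case: (mg_stepP T' c' u) => [xT'|xT' cT'|y' xT' yT' cy' ymin'].
  (* Otherwise [posT] leaves no missing key, the key sets coincide, and the key read cannot be in
     one only. *)
  + have iT' : i \notin T'.
      apply/negP => iT'; suff TT' : T = T' by rewrite TT' xT' in xT.
      apply: eqT; apply/fintype.subsetP => j jT; apply: contraTT (jT) => jT'.
      have : j \in T :\: T' by rewrite inE jT jT'.
      by move/(fintype.subsetP (posT cT)); rewrite inE => /eqP ji;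
        rewrite ji iT' in jT'.
    have card1 : #|T :\: T'| <= 1 by rewrite -(cards1 i) subset_leq_card// posT.
    have T'T j : j \in T' -> j != lshift k u -> j \in T.
      move=> jT' jx; apply/negPn/negP => jT; move: card1;
        rewrite cDC leqNgt => /negP[].
      apply: (@leq_trans #|[set j; lshift k u]|); first by rewrite cards2 jx.
      by apply: subset_leq_card; apply/fintype.subsetP => z;
        rewrite !inE => /orP[]/eqP ->; rewrite ?jT ?xT.
    apply: AdjacentAll => //= j jT'; rewrite !ffunE.
      case: eqVneq => [->|jx];
        first by rewrite (negPf xT) c0// -(cj (lshift k u)) ?c0//;
        apply: contraNneq iT' => <-.
      have jT := T'T j jT' jx; rewrite jT -cj; first by rewrite prednK// cT.
      by apply: contraNneq iT' => <-.
    case: (eqVneq j i) => [->|ji]; first by rewrite iT ci c0'.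
    by rewrite cj// c0'//; case: ifP.
  + have TT' := posT' cT'; apply: (AdjacentOne (i := i)) => //=.
    * by rewrite !ffunE -TT' iT ci prednK// cT'// -TT'.
    * by move=> j ji; rewrite !ffunE -TT' cj.
  (* The second sketch drops [y'], with counter 0. Either [y'] is [i] and the last clause of
     [AdjacentOne] gives equal key sets, or [y'] is missing from the first sketch and [i] from the
     second. *)
  + have y'T : y' != i -> y' \notin T.
      by move=> y'i; apply/negP => /cT; rewrite cj// cy'.
    have iT' : y' != i -> i \notin T'.
      move=> y'i; apply/negP => iT'; have TT' : T = T'.
        apply: eqT; apply/fintype.subsetP => j jT; apply: contraTT (jT) => jT'.
        have : j \in T :\: T' by rewrite inE jT jT'.
        by move/(fintype.subsetP (posT cT)); rewrite inE => /eqP ji;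
          rewrite ji iT' in jT'.
      by have := y'T y'i; rewrite TT' yT'.
    have card1 : #|T :\: T'| <= 1 by rewrite -(cards1 i) subset_leq_card// posT.
    have T'T j : j \in T' -> j != y' -> (j \in T) && (j != i).
      move=> jT' jy; case: (eqVneq y' i) => [y'i|y'i].
        by rewrite -y'i jy andbT iP// -y'i.
      rewrite andbC; have -> /= : j != i by apply: contraNneq (iT' y'i) => <-.
      apply/negPn/negP => jT; move: card1; rewrite cDC leqNgt => /negP[].
      apply: (@leq_trans #|[set j; y']|); first by rewrite cards2 jy.
      by apply: subset_leq_card; apply/fintype.subsetP => z;
        rewrite !inE => /orP[]/eqP ->; rewrite ?jT ?y'T.
    apply: AdjacentAll => /= [|j|j]; rewrite ?inE ?ffunE.
    * rewrite -(cards1 i); apply: subset_leq_card.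
      apply/fintype.subsetP => j; rewrite !inE => /andP[+ jT].
      have jx : j != lshift k u by apply: contraNneq xT => <-.
      rewrite (negPf jx)/= negb_and negbK => /orP[/eqP jy|jT'].
        by rewrite jy; apply: contraLR jT; rewrite jy => /y'T.
      by have := fintype.subsetP (posT cT) j; rewrite !inE jT jT' => /(_ isT).
    * case: (eqVneq j (lshift k u)) => [->|jx] /=.
        by rewrite (negPf xT) c0.
      case/andP=> jy jT'; have /andP[jT ji] := T'T j jT' jy.
      by rewrite jT -cj// prednK// cT.
    * case: (eqVneq j (lshift k u)) => [->|jx] /=.
        by rewrite (negPf xT) c0.
      rewrite negb_and negbK => /orP[/eqP ->|jT'].
        case: (eqVneq y' i) => [y'i|y'i]; last by rewrite cj// cy'; case: ifP.
        by rewrite y'i iT ci -y'i cy'.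
      case: (eqVneq j i) => [->|ji]; last by rewrite cj// c0'//; case: ifP.
      rewrite iT ci; case: (boolP (i \in T')) => [iT'2|/c0' ->//].
      case: (eqVneq y' i) => [y'i|/iT']; last by rewrite iT'2.
      by rewrite -y'i cy'.
- have yi : y != i by apply/eqP => yi; move: cy; rewrite yi ci.
  case: (mg_stepP T' c' u) => [xT'|xT' cT'|y' xT' yT' cy' ymin'].
  + have xi : lshift k u != i by apply: contraNneq xT => ->.
    apply: (AdjacentOne (i := i)) => /=.
    * apply: leq_trans card2; apply: subset_leq_card.
      apply/fintype.subsetP => j; rewrite !inE.
      by case: (eqVneq j (lshift k u)) => [->|_];
        rewrite ?xT'//= => /and3P[-> _ ->].
    * by rewrite !inE iT eq_sym yi orbT.
    * by rewrite !ffunE eq_sym (negPf xi).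
    * move=> j ji; rewrite !ffunE cj//; case: eqP => // ->.
      by rewrite -cj// c0.
    * rewrite ffunE eq_sym (negPf xi) => iT' /(iP iT') TT'.
      by rewrite TT' xT' in xT.
  + have TT' := posT' cT'; have := cT' y; rewrite -TT' yT => /(_ isT).
    by rewrite -cj// cy.
  + have xi : lshift k u != i by apply: contraNneq xT => ->.
    apply: (AdjacentOne (i := i)) => /=.
    (* If [y] was unshared it leaves the difference and makes room for [y']. If [y'] was unshared
       the difference does not grow. If [y'] is [i], the key sets were equal and only [i] becomes
       unshared. *)
    * case: (boolP (y \in T')) => yT'2; last first.
        apply: (leq_trans (subset_leq_card (_ : _ \subset y' |:
          ((T :\: T') :\ y)))).
          by apply/fintype.subsetP => j; rewrite !inE; do 4?case: (_ == _);
            case: (_ \in T); case: (_ \in T').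
        rewrite (leq_trans (leq_cardsU1 _ _))// (leq_trans _ card2)//.
        by rewrite (cardsD1 y (T :\: T')) !inE yT yT'2.
      case: (boolP (y' \in T)) => y'T; last first.
        apply: leq_trans card2; apply: subset_leq_card.
        apply/fintype.subsetP => j; rewrite !inE.
        case: (eqVneq j y') => [->|_]; last by do 4?case: (_ == _);
          case: (_ \in T); case: (_ \in T').
        have y'x : y' != lshift k u by apply: contraNneq xT' => <-.
        by rewrite (negPf y'x) (negPf y'T) !andbF.
      case: (eqVneq y' i) => [y'i|y'i].
        have TT' : T = T' by apply: iP; rewrite -y'i.
        apply: (@leq_trans #|[set y']|); last by rewrite cards1.
        apply: subset_leq_card; apply/fintype.subsetP => j; rewrite !inE -TT'.
        by do 4?case: (_ == _); case: (_ \in T).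
      (* Both keys are shared and have counter 0 in both sketches, so each is at most the other. *)
      have yy' : y = y'.
        apply/val_inj/eqP; rewrite eqn_leq /= ymin//=; last by rewrite cj.
        by rewrite ymin'// -cj.
      apply: leq_trans card2; apply: subset_leq_card.
      apply/fintype.subsetP => j; rewrite !inE yy'.
      by do 4?case: (_ == _); case: (_ \in T); case: (_ \in T').
    * by rewrite !inE iT eq_sym yi orbT.
    * by rewrite !ffunE eq_sym (negPf xi).
    * by move=> j ji; rewrite !ffunE cj.
    (* If [i] survives with counter 0, the key sets were equal and both sketches dropped the same
       smallest zero key. *)
    * rewrite !inE ffunE eq_sym (eq_sym i (lshift _ _)) (negPf xi) /= =>
        /andP[y'i iT'].
      move=> /(iP iT') TT'; have y'T : y' \in T by rewrite TT'.
      suff -> : y = y' by rewrite TT'.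
      apply/val_inj/eqP; rewrite eqn_leq /= ymin//=; last by rewrite cj.
      by rewrite ymin' -?TT'// -cj.
Qed.

Lemma mg_adjacent_foldl s s' (S : seq 'I_d) : well_formed s -> well_formed s' ->
  mg_adjacent s s' ->
  mg_adjacent (foldl (@mg_step d k) s S) (foldl (@mg_step d k) s' S).
Proof.
elim: S s s' => //= u S IH s s' ws ws' a.
by apply: IH; [exact: well_formed_step..|exact: mg_adjacent_step].
Qed.

Lemma mg_adjacent_delete (A B : seq 'I_d) u :
  mg_adjacent (mg k (A ++ u :: B)) (mg k (A ++ B)).
Proof.
rewrite /mg !foldl_cat /=; have wA := well_formed_mg A.
by apply: mg_adjacent_foldl => //;
  [exact: well_formed_step|exact: mg_adjacent_insert].
Qed.

End Sketches.

Import numFieldNormedType.Exports.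
Local Open Scope classical_set_scope.
Local Open Scope ring_scope.

(** * The Laplace distribution *)

Section LaplacePdf.
Variables (R : realType) (eps : R).
Hypothesis eps_gt0 : 0 < eps.
Local Notation mu := (@lebesgue_measure R).
Local Notation pdf := (laplace_pdf eps^-1).

Lemma laplace_pdfE (x : R) : pdf x = eps / 2 * expR (- (eps * `|x|)).
Proof. by rewrite /laplace_pdf invfM invrK [_ * eps]mulrC [`|x| * _]mulrC. Qed.

Lemma laplace_pdf_ge0 x : 0 <= pdf x.
Proof. by rewrite laplace_pdfE mulr_ge0 ?expR_ge0// divr_ge0// ltW. Qed.

Lemma continuous_laplace_pdf : continuous pdf.
Proof.
have -> : pdf = (fun x => eps / 2 * expR (- (eps * `|x|))).
  by apply/funext => x; rewrite laplace_pdfE.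
move=> x; apply: cvgM; first exact: cvg_cst.
apply: continuous_comp; last exact: continuous_expR.
by apply: cvgN; apply: cvgM; [exact: cvg_cst|exact: norm_continuous].
Qed.

Lemma measurable_laplace_pdf (D : set R) : measurable_fun D pdf.
Proof.
apply: measurable_funTS; apply: continuous_measurable_fun.
exact: continuous_laplace_pdf.
Qed.

(** By uniqueness of Lebesgue measure it suffices to compare lengths of half-open intervals. *)
Lemma lebesgue_measure_shift (a : R) (A : set R) : measurable A ->
  pushforward mu (fun x : R => x + a : measurableTypeR R) A = mu A.
Proof.
have mshift : measurable_fun [set: R] (fun x : R => x + a : measurableTypeR R).
  exact: measurable_funD.
pose f : {mfun R >-> measurableTypeR R} := HB.pack (fun x : R =>
  x + a : measurableTypeR R) (isMeasurableFun.Build _ _ _ _ _ mshift).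
move=> mA; apply/esym/(@lebesgue_measure_unique _ (pushforward mu f)) =>
  //= _ [[x y]] _ <-.
have -> : pushforward mu f `]x, y]%classic = mu `]x - a, y - a]%classic.
  congr (mu _); apply/seteqP; split => z /=; rewrite !in_itv/=; lra.
rewrite !lebesgue_measure_itv/= !lte_fin ltrD2r; case: ifP => // _.
by rewrite -!EFinD; congr EFin; ring.
Qed.

Lemma ge0_integral_shift (a : R) (A : set R) (f : R -> \bar R) :
  measurable A -> measurable_fun A f -> (forall x, 0 <= f x)%E ->
  (\int[mu]_(x in (fun x => (x + a)%R) @^-1` A) f (x + a)%R
   = \int[mu]_(x in A) f x)%E.
Proof.
move=> mA mf f0.
have mshift : measurable_fun [set: R] (fun x : R => x + a : measurableTypeR R).
  exact: measurable_funD.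
transitivity (\int[pushforward mu (fun x : R =>
  (x + a)%R : measurableTypeR R)]_(x in A) f x)%E.
  apply/esym/(@ge0_integral_pushforward _ _ (measurableTypeR R)
    (measurableTypeR R) R _ mshift mu A f mA mf).
  by move=> x _.
by apply: eq_measure_integral => //= B mB _; exact: lebesgue_measure_shift.
Qed.

Lemma laplace_pdf_shift (a x : R) :
  `|a| <= 1 -> pdf x <= expR eps * pdf (x + a).
Proof.
move=> a1; rewrite !laplace_pdfE mulrCA ler_pM2l ?divr_gt0//.
rewrite -expRD ler_expR.
have : `|x + a| <= `|x| + 1 by rewrite (le_trans (ler_normD _ _))// lerD2l.
by rewrite -(ler_pM2l eps_gt0); lra.
Qed.

(** Translation turns the right-hand integral into one of the shifted density over the preimage,
    where the pointwise bound applies. *)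
Lemma integral_laplace_pdf_shift (a : R) (A : set R) :
  `|a| <= 1 -> measurable A ->
  (\int[mu]_(x in (fun x => (x + a)%R) @^-1` A) (pdf x)%:E
   <= (expR eps)%:E * \int[mu]_(x in A) (pdf x)%:E)%E.
Proof.
move=> a1 mA.
have mS : measurable ((fun x => x + a) @^-1` A).
  by rewrite -[X in measurable X]setTI;
    exact: (measurable_funD (@measurable_id _ _ _) (measurable_cst a)).
rewrite -[X in (_ <= _ * X)%E](ge0_integral_shift a)//; last 2 first.
- by apply/measurable_EFinP; exact: measurable_laplace_pdf.
- by move=> x; rewrite lee_fin laplace_pdf_ge0.
have mp : measurable_fun ((fun x => x + a) @^-1` A) (fun x => (pdf (x + a))%:E).
  apply/measurable_EFinP/measurable_funTS/measurableT_comp => //.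
    exact: measurable_laplace_pdf.
  exact: measurable_funD.
rewrite -ge0_integralZl_EFin ?expR_ge0//; last first.
  by move=> x _; rewrite lee_fin laplace_pdf_ge0.
apply: ge0_le_integral => //.
- by move=> x _; rewrite lee_fin laplace_pdf_ge0.
- by apply/measurable_EFinP; exact: measurable_laplace_pdf.
- by apply: measurable_funeM.
- by move=> x _; rewrite -EFinM lee_fin laplace_pdf_shift.
Qed.

Lemma cvg_expRNM : expR (- (eps * x)) @[x --> +oo] --> (0 : R).
Proof.
apply: (@cvg_comp _ _ _ (fun x : R => eps * x) (fun z =>
  expR (- z)) _ (pinfty_nbhs R)).
  exact: gt0_cvgMry.
exact: cvgr_expR.
Qed.

Lemma integral_laplace_pdf_tail (t : R) : 0 <= t ->
  (\int[mu]_(x in `[t, +oo[) (pdf x)%:E = (2^-1 * expR (- (eps * t)))%:E)%E.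
Proof.
move=> t0.
have dF (x : R) : is_derive x 1 (fun x : R => - 2^-1 * expR (- (eps * x)))
    (eps / 2 * expR (- (eps * x))).
  by apply: is_derive_eq; rewrite /GRing.scale/= !mulr1; lra.
rewrite (@ge0_continuous_FTC2y _ _ (fun x => - 2^-1 * expR (- (eps * x))) _ 0).
- by rewrite sub0e -EFinN mulNr opprK.
- by move=> x _; exact: laplace_pdf_ge0.
- exact/continuous_subspaceT/continuous_laplace_pdf.
- rewrite -[X in _ --> X](mulr0 (- 2^-1)).
  by apply: cvgM; [exact: cvg_cst|exact: cvg_expRNM].
- by move=> x _; have [] := dF x.
- apply: cvg_at_right_filter.
  by have [/derivable1_diffP/differentiable_continuous] := dF t.
- move=> x; rewrite in_itv/= andbT => tx;
    rewrite derive1E derive_val laplace_pdfE.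
  by rewrite ger0_norm// (le_trans t0)// ltW.
Qed.

(** The cubic term of the exponential series bounds the function by [6 / (eps ^+ 3 * x)]. *)
Lemma cvg_sqr_expRNM : x ^+ 2 * expR (- (eps * x)) @[x --> +oo] --> (0 : R).
Proof.
apply: (@squeeze_cvgr _ _ _ _ (fun=> 0) (fun x => (6 / eps ^+ 3) * x^-1)).
- near=> x; have x0 : 0 < x by near: x; exact: nbhs_pinfty_gt.
  rewrite mulr_ge0 ?expR_ge0 ?sqr_ge0//=.
  have ex0 : 0 <= eps * x by rewrite mulr_ge0// ltW.
  have e3 := expR_ge1Dxn 2 ex0; rewrite expRN ler_pdivrMr ?expR_gt0//.
  have e3' : (eps * x) ^+ 3 / 6 <= expR (eps * x).
    by apply: le_trans e3; rewrite lerDr.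
  apply: le_trans (ler_wpM2l _ e3'); last first.
    by rewrite mulr_ge0 ?invr_ge0 ?divr_ge0 ?exprn_ge0// ltW.
  rewrite le_eqVlt; apply/orP; left; apply/eqP; field.
  by rewrite !gt_eqF.
- exact: cvg_cst.
- rewrite -[X in _ --> X](mulr0 (6 / eps ^+ 3)).
  apply: cvgM; first exact: cvg_cst.
  apply/(gtr0_cvgV0 (f := id)); last exact: cvg_id.
  exact: nbhs_pinfty_gt.
Unshelve. all: by end_near. Qed.

Lemma cvg_id_expRNM : x * expR (- (eps * x)) @[x --> +oo] --> (0 : R).
Proof.
apply: (@squeeze_cvgr _ _ _ _ (fun=> 0) (fun x => x ^+ 2 * expR (- (eps * x)))).
- near=> x; have x1 : 1 <= x by near: x; exact: nbhs_pinfty_ge.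
  have x0 : 0 <= x := le_trans ler01 x1.
  by rewrite mulr_ge0 ?expR_ge0//= ler_wpM2r ?expR_ge0// expr2 ler_peMl.
- exact: cvg_cst.
- exact: cvg_sqr_expRNM.
Unshelve. all: by end_near. Qed.

Lemma integral_sqr_laplace_pdf :
  (\int[mu]_x (x ^+ 2 * pdf x)%:E = (2 / eps ^+ 2)%:E)%E.
Proof.
have f0 (x : R) : 0 <= x ^+ 2 * pdf x.
  by rewrite mulr_ge0 ?sqr_ge0 ?laplace_pdf_ge0.
have cf : continuous (fun x : R => x ^+ 2 * pdf x).
  move=> x; apply: cvgM; last exact: continuous_laplace_pdf.
  by apply: (@exprn_continuous _ 2).
rewrite ge0_symfun_integralT//; last first.
  by move=> x /=; rewrite sqrrN !laplace_pdfE normrN.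
(* Antiderivative on the positive half-line, from integrating by parts twice; [F 0] is
   [- 1 / eps ^+ 2], and symmetry doubles the result. *)
pose F (x : R) := - 2^-1 * (x ^+ 2 * expR (- (eps * x)) + 2 / eps * (x * expR
  (- (eps * x)))
   + 2 / eps ^+ 2 * expR (- (eps * x))).
have dF (x : R) : is_derive x 1 F (x ^+ 2 * (eps / 2 * expR (- (eps * x)))).
  apply: is_derive_eq; rewrite /GRing.scale/= ?mulr1 ?expr1.
  by field; rewrite gt_eqF.
rewrite -set_itvcy (@ge0_continuous_FTC2y _ _ F _ 0)//.
- rewrite /F !(mulr0, expr0n, mul0r)/= oppr0 expR0 -EFinB -EFinM; congr EFin.
  by field; rewrite gt_eqF.
- exact/continuous_subspaceT.
- rewrite -[X in _ --> X](mulr0 (- 2^-1)); apply: cvgM; first exact: cvg_cst.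
  rewrite -[X in _ --> X]addr0 -[X in _ --> X + _](addr0 0); apply: cvgD;
    first apply: cvgD.
  + exact: cvg_sqr_expRNM.
  + rewrite -[X in _ --> X](mulr0 (2 / eps)); apply: cvgM; first exact: cvg_cst.
    exact: cvg_id_expRNM.
  + rewrite -[X in _ --> X](mulr0 (2 / eps ^+ 2)); apply: cvgM;
      first exact: cvg_cst.
    exact: cvg_expRNM.
- apply: cvg_at_right_filter.
  by have [/derivable1_diffP/differentiable_continuous] := dF 0.
- move=> x; rewrite in_itv/= andbT => tx;
    rewrite derive1E derive_val laplace_pdfE.
  by rewrite ger0_norm// ltW.
Qed.

End LaplacePdf.

(** * Integrals against a measure with a density *)

Section Density.
Local Open Scope ereal_scope.
Context {dsp : measure_display} {T : measurableType dsp} {R : realType}.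
Variables (mu nu : {measure set T -> \bar R}) (f : T -> R).
Hypothesis mf : measurable_fun [set: T] f.
Hypothesis f_ge0 : forall x, (0 <= f x)%R.
Hypothesis nuE : forall A, measurable A -> nu A = \int[mu]_(x in A) (f x)%:E.

Import HBNNSimple.

Lemma integral_density_nnsfun (h : {nnsfun T >-> R}) :
  \int[nu]_x (h x)%:E = \int[mu]_x ((h x)%:E * (f x)%:E).
Proof.
transitivity (\sum_(r \in range h) \int[mu]_x
  ((r * \1_(h @^-1` [set r]) x)%:E * (f x)%:E)).
  under eq_integral do rewrite fimfunE -fsumEFin//.
  rewrite ge0_integral_fsum//; last 2 first.
  - by move=> y; exact/measurable_EFinP/measurable_funM.
  - by move=> y x _; rewrite nnfun_muleindic_ge0.
  apply: eq_fsbigr => r /[!inE] -[x _ <-].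
  rewrite integralZl_indic_nnsfun// integral_indic//= setIT nuE//.
  under [RHS]eq_integral do rewrite EFinM -muleA.
  rewrite ge0_integralZl_EFin//; last 2 first.
  - by move=> z _; rewrite mule_ge0// lee_fin.
  - by apply: emeasurable_funM; apply/measurable_EFinP.
  congr (_ * _); rewrite [LHS]integral_mkcond; apply: eq_integral => z _.
  by rewrite patchE indicE; case: (z \in _); rewrite ?mul1e ?mul0e.
rewrite -ge0_integral_fsum//.
- apply: eq_integral => x _; rewrite -ge0_mule_fsuml//; last first.
    by move=> r; rewrite nnfun_muleindic_ge0.
  by rewrite fsumEFin// -fimfunE.
- move=> r; apply: emeasurable_funM;
    first exact/measurable_EFinP/measurable_funM.
  exact/measurable_EFinP.
- by move=> r x _; rewrite mule_ge0 ?lee_fin// -lee_fin nnfun_muleindic_ge0.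
Qed.

(** Monotone convergence on both sides along simple functions; multiplying by the nonnegative
    density keeps the approximation monotone. *)
Lemma ge0_integral_density (g : T -> \bar R) :
  measurable_fun [set: T] g -> (forall x, 0 <= g x) ->
  \int[nu]_x g x = \int[mu]_x (g x * (f x)%:E).
Proof.
move=> mg g0; pose h := nnsfun_approx measurableT mg.
transitivity (limn (fun n => \int[nu]_x (h n x)%:E)).
  rewrite -monotone_convergence//.
  - apply: eq_integral => y _; apply/esym/cvg_lim => //.
    exact: cvg_nnsfun_approx.
  - by move=> n; exact/measurable_EFinP/measurable_funP.
  - by move=> n y _; rewrite lee_fin.
  - by move=> y _ m n mn; rewrite lee_fin; exact/lefP/nd_nnsfun_approx.
transitivity (limn (fun n => \int[mu]_x ((h n x)%:E * (f x)%:E))).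
  by apply: congr_lim; apply/funext => n; exact: integral_density_nnsfun.
rewrite -monotone_convergence//.
- apply: eq_integral => y _; apply/cvg_lim => //.
  by apply: cvgeZr => //; exact: cvg_nnsfun_approx.
- move=> n; apply: emeasurable_funM; last exact/measurable_EFinP.
  exact/measurable_EFinP/measurable_funP.
- by move=> n y _; rewrite mule_ge0 ?lee_fin.
- move=> y _ m n mn; rewrite lee_wpmul2r ?lee_fin//.
  exact/lefP/nd_nnsfun_approx.
Qed.

End Density.

Lemma measurable_set_le (dsp : measure_display) (T : measurableType dsp)
    (R : realType) (f g : T -> R) :
  measurable_fun [set: T] f -> measurable_fun [set: T] g ->
  measurable [set x | f x <= g x].
Proof.
by move=> mf mg; rewrite -[X in measurable X]setTI; exact: measurable_fun_le.
Qed.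

Lemma measurable_set_lt (dsp : measure_display) (T : measurableType dsp)
    (R : realType) (f g : T -> R) :
  measurable_fun [set: T] f -> measurable_fun [set: T] g ->
  measurable [set x | f x < g x].
Proof.
move=> mf mg; have -> : [set x | f x < g x] = ~` [set x | g x <= f x].
  by apply/seteqP; split => x /=; rewrite ltNge => /negP.
exact/measurableC/measurable_set_le.
Qed.

(** * Shifts, tails and second moment of a Laplace variable *)

Section LaplaceVariable.
Context {R : realType} {dsp : measure_display} {Omega : measurableType dsp}.
Context {P : probability Omega R}.
Variables (eps : R) (X : {RV P >-> R}).
Hypothesis eps_gt0 : 0 < eps.
Hypothesis lapX : laplace_distributed eps^-1 X.

Lemma laplace_shift (a : R) (A : set R) : `|a| <= 1 -> measurable A ->
  (P [set w | A (X w + a)%R] <= (expR eps)%:E * P (X @^-1` A))%E.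
Proof.
move=> a1 mA; have := integral_laplace_pdf_shift eps_gt0 a1 mA.
rewrite -(lapX mA) -lapX//.
by rewrite -[X in measurable X]setTI;
  exact: (measurable_funD (@measurable_id _ _ _) (measurable_cst a)).
Qed.

Lemma laplace_tail (t : R) : 0 <= t ->
  (P [set w | t <= X w]%R = (2^-1 * expR (- (eps * t)))%:E)%E.
Proof.
move=> t0; rewrite -integral_laplace_pdf_tail// -lapX//; congr (P _).
by apply/seteqP; split => w /=; rewrite in_itv/= andbT.
Qed.

Lemma laplace_tailN (t : R) : 0 <= t ->
  (P [set w | X w <= - t]%R = (2^-1 * expR (- (eps * t)))%:E)%E.
Proof.
move=> t0; rewrite -integral_laplace_pdf_tail//.
have -> : [set w | X w <= - t] = X @^-1` `]-oo, -t].
  by apply/seteqP; split => w /=; rewrite in_itv/=.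
transitivity (\int[lebesgue_measure]_(x in `]-oo, (-t)%R])
  (laplace_pdf eps^-1 x)%:E)%E.
  exact: lapX.
rewrite ge0_integration_by_substitutionNy.
- by apply: eq_integral => x _; rewrite /= !laplace_pdfE normrN.
- exact/continuous_subspaceT/continuous_laplace_pdf.
- by move=> x _; exact: laplace_pdf_ge0.
Qed.

Lemma laplace_abs_tail (t : R) : 0 <= t ->
  (P [set w | t < `|X w|]%R <= (expR (- (eps * t)))%:E)%E.
Proof.
move=> t0.
have mL : measurable [set w | t <= X w].
  exact: measurable_set_le.
have mU : measurable [set w | X w <= - t].
  exact: measurable_set_le.
apply: (@le_trans _ _ (P ([set w | t <= X w] `|` [set w | X w <= - t]))).
  apply: le_measure; rewrite ?inE.
  - by apply: measurable_set_lt => //; exact: measurableT_comp.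
  - exact: measurableU.
  - by move=> w /=; rewrite ltr_normr => /orP[] /ltW; [left|right;
      rewrite lerNr].
apply: (le_trans (measureU2 _ mL mU));
  rewrite /= laplace_tail// laplace_tailN//.
by rewrite -EFinD lee_fin; lra.
Qed.

Lemma laplace_second_moment :
  ('E_P[fun w => (X w ^+ 2)%R] = (2 / eps ^+ 2)%:E)%E.
Proof.
rewrite unlock -integral_sqr_laplace_pdf//.
have msq : measurable_fun [set: R] (fun x : R => (x ^+ 2)%:E).
  by apply/measurable_EFinP; exact: measurable_funX.
have mX : measurable_fun [set: Omega] (X : Omega -> measurableTypeR R).
  exact: (@measurable_funP _ _ _ R setT X).
pose Y : {mfun Omega >-> measurableTypeR R} :=
  HB.pack (X : Omega -> measurableTypeR R) (isMeasurableFun.Build _ _ _ _ _ mX).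
transitivity (\int[distribution P Y]_x (x ^+ 2)%:E)%E.
  by rewrite ge0_integral_distribution// => x; rewrite lee_fin sqr_ge0.
rewrite (@ge0_integral_density _ _ _ lebesgue_measure (distribution P Y)
  (laplace_pdf eps^-1)).
- by under eq_integral do rewrite -EFinM.
- exact: measurable_laplace_pdf.
- exact: laplace_pdf_ge0.
- exact: lapX.
- exact: msq.
- by move=> x; rewrite lee_fin sqr_ge0.
Qed.

End LaplaceVariable.

(** * Perturbing one of several independent variables *)

Section IndependentOfPiSystem.
Context {R : realType} {dsp : measure_display} {Omega : measurableType dsp}.
Variables (P : probability Omega R) (G : set (set Omega)).
Hypotheses (Gm : G `<=` measurable) (GI : setI_closed G) (GT : G [set: Omega]).

Local Notation OmegaG := (g_sigma_algebraType G).

Definition indep_of_system (X : Omega -> R) : Prop :=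
  forall B C, measurable B -> G C ->
    P (X @^-1` B `&` C) = (P (X @^-1` B) * P C)%E.

Lemma g_sigma_algebra_sub (C : set Omega) : <<s G >> C -> measurable C.
Proof. exact: (smallest_sub (@sigma_algebra_measurable _ Omega) Gm). Qed.

Lemma measurable_id_system : measurable_fun [set: Omega] (id : Omega -> OmegaG).
Proof. by move=> _ C mC; rewrite setTI; exact: g_sigma_algebra_sub. Qed.

Let idG : {mfun Omega >-> OmegaG} :=
  HB.pack (id : Omega -> OmegaG)
    (isMeasurableFun.Build _ _ _ _ _ measurable_id_system).

(** For fixed [B] both sides are finite measures in [C] that agree on the pi-system [G], hence on
    the sigma-algebra it generates. *)
Lemma indep_of_sigma_algebra (X : {RV P >-> R}) (B : set R) (C : set Omega) :
  indep_of_system X -> measurable B -> <<s G >> C ->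
  P (X @^-1` B `&` C) = (P (X @^-1` B) * P C)%E.
Proof.
move=> iX mB GC; have mXB : measurable (X @^-1` B).
  by rewrite -[X in measurable X]setTI; exact: (measurable_funPT X).
have p0 : 0 <= fine (P (X @^-1` B)) by rewrite fine_ge0.
rewrite setIC -[LHS]/(mrestr P mXB C).
transitivity (mscale (NngNum p0) P C);
  last by rewrite /mscale/= fineK// fin_num_measure.
apply: (g_sigma_algebra_measure_unique G Gm (fun=> setT)) => //.
- by rewrite bigcup_const//; exists 0%N.
- move=> D GD; rewrite /= /mrestr /mscale/= setIC iX// fineK//.
  by rewrite fin_num_measure.
- move=> n; rewrite /= /mrestr setTI.
  by rewrite (le_lt_trans (probability_le1 _ _))// ltry.
Qed.

Lemma measurable_pair_system (X : {RV P >-> R}) :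
  measurable_fun [set: Omega] (fun w => (X w, w) : R * OmegaG).
Proof.
apply/measurable_fun_pairP; split; first exact: measurable_funPT.
exact: measurable_id_system.
Qed.

(* Equipped with the sigma-algebra generated by [G], [Omega] itself is the
   second factor: no product space is needed for the variables that [G] stands
   for. *)
Lemma joint_law (X : {RV P >-> R}) (A : set (R * OmegaG)) :
  indep_of_system X -> measurable A ->
  P [set w | A (X w, w)] = (distribution P X \x^ distribution P idG)%E A.
Proof.
move=> iX mA.
pose XG : {mfun Omega >-> (R * OmegaG)%type} :=
  HB.pack (fun w => (X w, w) : R * OmegaG)
    (isMeasurableFun.Build _ _ _ _ _ (measurable_pair_system X)).
transitivity ((distribution P X \x distribution P idG)%E A).
  apply/esym; apply: (product_measure_unique (m' := distribution P XG)) => //.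
  by move=> B C mB mC; exact: indep_of_sigma_algebra.
apply: (product_measure_unique (m' :=
  (distribution P X \x^ distribution P idG)%E)) => //.
by move=> B C mB mC; rewrite /= product_measure2E.
Qed.

(** Lifts a comparison of one-dimensional laws to events involving everything else: the joint law
    integrates the laws of sections of [A], and the comparison holds section by section. *)
Lemma indep_law_le (X Y : {RV P >-> R}) (K : R) (A : set (R * OmegaG)) :
  indep_of_system X -> indep_of_system Y -> 0 <= K ->
  (forall B, measurable B -> P (Y @^-1` B) <= K%:E * P (X @^-1` B))%E ->
  measurable A ->
  (P [set w | A (Y w, w)] <= K%:E * P [set w | A (X w, w)])%E.
Proof.
move=> iX iY K0 XY mA; rewrite !joint_law// /product_measure2.
rewrite -ge0_integralZl_EFin//; last exact: measurable_fun_ysection.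
apply: ge0_le_integral => //.
- exact: measurable_fun_ysection.
- by apply: measurable_funeM; exact: measurable_fun_ysection.
- by move=> y _; apply: XY; exact: measurable_ysection.
Qed.

End IndependentOfPiSystem.

Section IndependentCoordinate.
Context {R : realType} {dsp : measure_display} {Omega : measurableType dsp}.
Context {P : probability Omega R} {I : finType}.
Variables (N : I -> {RV P >-> R}) (j : I).
Hypothesis indN : mutually_independent N.

(** A pi-system generating the sigma-algebra of all the variables except [N j]. *)
Definition other_cylinders : set (set Omega) :=
  [set C | exists B : I -> set R, (forall i, measurable (B i)) /\
     C = \bigcap_(i in [set i | i != j]) N i @^-1` B i].

Lemma measurable_preimage_RV (X : {RV P >-> R}) (B : set R) :
  measurable B -> measurable (X @^-1` B).
Proof.
by move=> mB; rewrite -[X in measurable X]setTI; exact: (measurable_funPT X).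
Qed.

Lemma other_cylinders_measurable : other_cylinders `<=` measurable.
Proof.
move=> _ [B [mB ->]]; apply: fin_bigcap_measurable => [|i _];
  first exact: finite_finset.
exact: measurable_preimage_RV.
Qed.

Lemma other_cylinders_setI : setI_closed other_cylinders.
Proof.
move=> _ _ [B [mB ->]] [C [mC ->]]; exists (fun i => B i `&` C i).
split; first by move=> i; exact: measurableI.
by rewrite -bigcapI.
Qed.

Lemma other_cylinders_setT : other_cylinders [set: Omega].
Proof.
exists (fun=> setT); split => //; apply/seteqP; split => // w _ i _ //.
Qed.

Lemma other_cylinders_preimage (i : I) (B : set R) :
  i != j -> measurable B -> other_cylinders (N i @^-1` B).
Proof.
move=> ij mB; exists (fun i' => if i' == i then B else setT); split.
  by move=> i'; case: ifP.
apply/seteqP; split => [w wB i' _|w /(_ i ij)]; last by rewrite eqxx.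
by rewrite /=; case: eqP => // ->.
Qed.

(** The product rule with [D] at coordinate [j] factors out [N j]; the same rule with the whole line
    at [j] identifies the remaining product as [P C]. *)
Lemma indep_other_cylinders : indep_of_system P other_cylinders (N j).
Proof.
move=> B _ mB [C [mC ->]].
have E (D : set R) : measurable D ->
    P (N j @^-1` D `&` \bigcap_(i in [set i | i != j]) N i @^-1` C i) =
    (P (N j @^-1` D) * \prod_(i | i != j) P (N i @^-1` C i))%E.
  move=> mD; pose D' i := if i == j then D else C i.
  have -> : N j @^-1` D `&` \bigcap_(i in [set i | i != j]) N i @^-1` C i =
      \bigcap_(i in [set: I]) N i @^-1` D' i.
    apply/seteqP; split => [w [wD wC] i _|w wD']; rewrite /D'.
      by rewrite /preimage/=; case: eqVneq => [->//|/wC].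
    split; first by have := wD' j Logic.I; rewrite /D'/= eqxx.
    by move=> i ij; have := wD' i Logic.I; rewrite /D'/= (negPf ij).
  rewrite indN => [|i]; last by rewrite /D'; case: ifP.
  rewrite (bigD1 j)//= /D' eqxx; congr (_ * _)%E.
  by apply: eq_bigr => i /negPf ->.
rewrite E//; congr (_ * _)%E.
by have := E setT measurableT;
  rewrite preimage_setT setTI probability_setT mul1e => ->.
Qed.

Lemma indep_other_cylinders_comp (phi : R -> R) (Y : {RV P >-> R}) :
  measurable_fun [set: R] phi -> (forall w, Y w = phi (N j w)) ->
  indep_of_system P other_cylinders Y.
Proof.
move=> mphi YE B C mB GC; have -> : Y @^-1` B = N j @^-1` (phi @^-1` B).
  by apply/seteqP; split => w /=; rewrite YE.
apply: indep_other_cylinders => //.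
by rewrite -[X in measurable X]setTI; exact: mphi.
Qed.

End IndependentCoordinate.

(** * Privacy *)

Lemma measure_bigsetU_le (dsp : measure_display) (T : measurableType dsp)
    (R : realType) (mu : {measure set T -> \bar R}) (I : Type) (r : seq I)
    (F : I -> set T) (c : R) :
  (forall i, measurable (F i)) -> (forall i, mu (F i) <= c%:E)%E ->
  (mu (\big[setU/set0]_(i <- r) F i) <= ((size r)%:R * c)%:E)%E.
Proof.
move=> mF Fc; elim: r => [|i r IH]; first by rewrite big_nil measure0 mul0r.
rewrite big_cons /=.
have mU : measurable
  (\big[setU/set0]_(i <- r) F i) by exact: bigsetU_measurable.
apply: (le_trans (measureU2 mu (mF i) mU)).
by rewrite -nat1r mulrDl mul1r EFinD; apply: leeD; [exact: Fc|exact: IH].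
Qed.

Section NoisyOutput.
Variables (R : realType) (d k : nat) (eps delta : R).
Local Notation key := ('I_(d + k)).
Local Notation thr := (threshold eps delta).
Implicit Types (s : sketch d k nat) (n : option key -> R) (x : key).

(* [None] indexes the shared noise, [Some x] the noise of key [x]. *)
Definition noisy_output s n : sketch d k R :=
  release eps delta (add_noise s (n None) (fun x => n (Some x))).

Arguments noisy_output : simpl never.

Definition noisy_count s n x : R := (s.2 x)%:R + n None + n (Some x).

Lemma mem_noisy_output s n x :
  (x \in (noisy_output s n).1) = (x \in s.1) && (thr <= noisy_count s n x).
Proof. by rewrite !inE ffunE; case: ifP. Qed.

Lemma noisy_outputE s n x : (noisy_output s n).2 x =
  if (x \in s.1) && (thr <= noisy_count s n x) then noisy_count s n x else 0.
Proof.
by rewrite ffunE -mem_noisy_output; case: ifP => //;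
  rewrite mem_noisy_output ffunE => /andP[->].
Qed.

(** Reduces equality of outputs to single keys: a key stored on one side only is harmless while its
    noisy count is below the threshold. *)
Lemma noisy_output_eq s s' n n' :
  (forall x, [/\ x \in s.1, x \in s'.1 &
                 noisy_count s n x = noisy_count s' n' x] \/
     (x \in s.1 -> noisy_count s n x < thr) /\
     (x \in s'.1 -> noisy_count s' n' x < thr)) ->
  noisy_output s n = noisy_output s' n'.
Proof.
move=> H.
have E x : (x \in s.1) && (thr <= noisy_count s n x) =
           (x \in s'.1) && (thr <= noisy_count s' n' x).
  case: (H x) => [[-> -> ->]//|[H1 H2]].
  have -> : (x \in s.1) && (thr <= noisy_count s n x) = false.
    by apply/negbTE/negP => /andP[/H1]; rewrite ltNge => /negbTE ->.
  by apply/esym/negbTE/negP => /andP[/H2]; rewrite ltNge => /negbTE ->.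
rewrite [LHS]surjective_pairing [RHS]surjective_pairing; congr pair.
  by apply/setP => x; rewrite !mem_noisy_output.
apply/ffunP => x; rewrite !noisy_outputE E.
case: ifP => // /andP[xs' le']; case: (H x) => [[_ _ ->]//|[_ /(_ xs')]].
by rewrite ltNge le'.
Qed.

Lemma measurable_noisy_count (dsp : measure_display) (D : measurableType dsp)
    (n : option key -> D -> R) s x :
  (forall i, measurable_fun [set: D] (n i)) ->
  measurable_fun [set: D] (fun p => noisy_count s (n^~ p) x).
Proof.
by move=> mn; apply: measurable_funD => //; apply: measurable_funD.
Qed.

Lemma measurable_noisy_output2 (dsp : measure_display) (D : measurableType dsp)
    (n : option key -> D -> R) s x :
  (forall i, measurable_fun [set: D] (n i)) ->
  measurable_fun [set: D] (fun p => (noisy_output s (n^~ p)).2 x).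
Proof.
move=> mn; under eq_fun do rewrite noisy_outputE.
case: (x \in s.1) => /=; last exact: measurable_cst.
apply: measurable_fun_ifT => //; last exact: measurable_noisy_count.
by apply: measurable_fun_ler => //; exact: measurable_noisy_count.
Qed.

(** The domain [D] is left general: it will be [Omega], and also the line times [Omega] with the
    sigma-algebra of the unshifted noises. *)
Lemma measurable_noisy_output (dsp : measure_display) (D : measurableType dsp)
    (n : option key -> D -> R) s (Z : set (sketch d k R)) :
  (forall i, measurable_fun [set: D] (n i)) ->
  <<s @output_generators R d k >> Z ->
  measurable [set p | Z (noisy_output s (n^~ p))].
Proof.
move=> mn GZ; rewrite -[X in measurable X]setTI.
have := sigma_algebra_image (fun p => noisy_output s (n^~ p))
  (@sigma_algebra_measurable _ D).
move=> sa; apply: (smallest_sub sa _ GZ) => _ [x [->|[B mB ->]]].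
  rewrite /image_set_system /= setTI.
  case: (boolP (x \in s.1)) => xs.
    rewrite (_ : _ @^-1` _ = [set p | thr <= noisy_count s (n^~ p) x]).
      by apply: measurable_set_le => //; exact: measurable_noisy_count.
    by apply/seteqP; split => p; rewrite /preimage /mkset mem_noisy_output xs.
  rewrite (_ : _ @^-1` _ = set0)//.
  apply/seteqP; split => p //.
  by rewrite /preimage /mkset mem_noisy_output (negPf xs).
by rewrite /image_set_system /=; exact: measurable_noisy_output2.
Qed.

Definition shift_noise (j : option key) (a : R) n : option key -> R :=
  fun i => if i == j then n i + a else n i.

End NoisyOutput.

Arguments noisy_output : simpl never.

Section Privacy.
Context {R : realType} {dsp : measure_display} {Omega : measurableType dsp}.
Context {P : probability Omega R}.
Variables (d k : nat) (eps delta : R).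
Local Notation key := ('I_(d + k)).
Variable N : option key -> {RV P >-> R}.
Hypotheses (eps_gt0 : 0 < eps) (delta_gt0 : 0 < delta) (delta_le1 : delta <= 1).
Hypothesis lapN : forall i, laplace_distributed eps^-1 (N i).
Hypothesis indN : mutually_independent N.
Local Notation thr := (threshold eps delta).
Local Notation out := (noisy_output eps delta).
Local Notation G := (@output_generators R d k).
Local Notation t := (ln (3 / delta) / eps).

(** The event is written as [A] evaluated at the pair of noise [j] and the remaining noises, so that
    [indep_law_le] reduces the claim to [laplace_shift]. *)
Lemma shift_noise_le (j : option key) (a : R) s (Z : set (sketch d k R)) :
  `|a| <= 1 -> <<s G >> Z ->
  (P [set w | Z (out s (shift_noise j a (fun i => N i w)))] <=
   (expR eps)%:E * P [set w | Z (out s (fun i => N i w))])%E.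
Proof.
move=> a1 GZ.
have mY : measurable_fun [set: Omega] (fun w => N j w + a).
  exact: measurable_funD.
pose Y : {RV P >-> R} := HB.pack (fun w => N j w + a)
  (isMeasurableFun.Build _ _ _ _ _ mY).
pose C := other_cylinders N j.
pose A : set (R * g_sigma_algebraType C) :=
  [set p | Z (out s (fun i => if i == j then p.1 else N i p.2))].
have -> : [set w | Z (out s (shift_noise j a (fun i => N i w)))] =
    [set w | A (Y w, w)].
  congr mkset; apply/funext => w; congr (Z (out s _)); apply/funext => i.
  by rewrite /shift_noise /=; case: eqP => // ->.
have -> : [set w | Z (out s (fun i => N i w))] = [set w | A (N j w, w)].
  congr mkset; apply/funext => w; congr (Z (out s _)); apply/funext => i /=.
  by case: eqP => // ->.
have mA : measurable A.
  apply: (measurable_noisy_output eps delta s (n := fun i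
    (p : R * g_sigma_algebraType C) =>
    if i == j then p.1 else N i p.2)) => // i.
  case: eqP => [_|/eqP ij]; first exact: measurable_fst.
  apply: (@measurableT_comp _ _ _ _ _ _ (N i : g_sigma_algebraType C -> R));
    last exact: measurable_snd.
  move=> _ B mB; rewrite setTI; apply: sub_sigma_algebra.
  exact: other_cylinders_preimage.
apply: indep_law_le => //.
- exact: other_cylinders_measurable.
- exact: other_cylinders_setI.
- exact: other_cylinders_setT.
- exact: indep_other_cylinders.
- apply: (indep_other_cylinders_comp indN (phi := fun x => x + a)) => //.
  exact: measurable_funD.
- by move=> B mB; exact: laplace_shift.
Qed.

Lemma noise_tail i : (P [set w | t <= N i w]%R = (delta / 6)%:E)%E.
Proof.
have t0 : 0 <= ln (3 / delta).
  by rewrite ln_ge0// ler_pdivlMr// mul1r (le_trans delta_le1)// ler1n.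
rewrite (laplace_tail eps_gt0 (lapN i)) ?divr_ge0 ?(ltW eps_gt0)//.
congr EFin; rewrite mulrCA divff ?gt_eqF// mulr1 expRN lnK ?posrE ?divr_gt0//.
by field; rewrite gt_eqF.
Qed.

(** Unless some noise in [r] reaches [t], the output on [s] is that on [s'] with shifted noise. The
    exceptional event has at most six parts of probability [delta / 6]. *)
Lemma dp_of_shift s s' (r : seq (option key)) (j : option key) (a : R)
    (Z : set (sketch d k R)) :
  `|a| <= 1 -> (size r <= 6)%N ->
  (forall n, (forall i, i \in r -> n i < t) ->
     out s n = out s' (shift_noise j a n)) ->
  <<s G >> Z ->
  (P [set w | Z (out s (fun i => N i w))] <=
   (expR eps)%:E * P [set w | Z (out s' (fun i => N i w))] + delta%:E)%E.
Proof.
move=> a1 size_r eq_out GZ.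
pose bad := \big[setU/set0]_(i <- r) [set w | t <= N i w].
have mt i : measurable [set w | t <= N i w] by exact: measurable_set_le.
have mbad : measurable bad by exact: bigsetU_measurable.
pose shifted := [set w | Z (out s' (shift_noise j a (fun i => N i w)))].
have mshifted : measurable shifted.
  apply: (measurable_noisy_output eps delta s' (n := fun i w =>
    shift_noise j a (fun i => N i w) i)) => // i.
  by rewrite /shift_noise; case: eqP => // _; exact: measurable_funD.
apply: (@le_trans _ _ (P (shifted `|` bad))).
  apply: le_measure; rewrite ?inE.
  - exact: (measurable_noisy_output eps delta s (n := fun i w => N i w)).
  - exact: measurableU.
  - move=> w /= Zw; have [wbad|wgood] := pselect (bad w); [by right|left].
    rewrite /shifted /= -eq_out// => i ir; rewrite ltNge; apply/negP => ti.
    by apply: wgood; rewrite /bad big_seq -bigcup_seq_cond; exists i => //=;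
      rewrite ir.
apply: (le_trans (measureU2 _ mshifted mbad)); apply: leeD;
  first exact: shift_noise_le.
have tail i : (P [set w | t <= N i w]%R <=
  (delta / 6)%:E)%E by rewrite noise_tail.
apply: (le_trans (measure_bigsetU_le r mt tail)).
rewrite lee_fin mulrCA ger_pMr// ler_pdivrMr// mul1r.
by rewrite (ler_nat _ (size r) 6).
Qed.

(** The threshold is [1 + 2 * t], so a key with counter at most 1 is suppressed when both its noises
    are below [t]. *)
Lemma lt_threshold (m x y : R) : m <= 1 -> x < t -> y < t -> m + x + y < thr.
Proof. by rewrite /threshold -mulrA; lra. Qed.

Lemma noisy_count_shift_shared (s : sketch d k nat) (a : R) n x :
  noisy_count s (shift_noise None a n) x = (s.2 x)%:R + a + n None + n (Some x).
Proof. by rewrite /noisy_count /shift_noise eqxx /=; ring. Qed.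

Lemma noisy_count_shift_key (s : sketch d k nat) (a : R) n x y :
  noisy_count s (shift_noise (Some y) a n) x =
  (s.2 x)%:R + (if x == y then a else 0) + n None + n (Some x).
Proof.
rewrite /noisy_count /shift_noise /= -[Some x == Some y]/(x == y).
by case: eqP => _; ring.
Qed.

(** [AdjacentAll] is compensated by the shared noise, [AdjacentOne] by the noise of [i], with
    opposite signs in the two directions. Shared keys then have equal noisy counts; an unshared key
    has counter at most 1, before and after compensation. *)
Lemma dp_adjacent (s s' : sketch d k nat) (Z : set (sketch d k R)) :
  well_formed s -> well_formed s' -> mg_adjacent s s' -> <<s G >> Z ->
  (P [set w | Z (out s (fun i => N i w))] <=
   (expR eps)%:E * P [set w | Z (out s' (fun i => N i w))] + delta%:E)%E /\
  (P [set w | Z (out s' (fun i => N i w))] <=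
   (expR eps)%:E * P [set w | Z (out s (fun i => N i w))] + delta%:E)%E.
Proof.
move=> [cs c0] [cs' c0'] adj GZ.
pose D := (s.1 :\: s'.1)%SET; pose D' := (s'.1 :\: s.1)%SET.
(* The noises that must stay below [t]: the shared one and those of the unshared keys. *)
pose r : seq (option key) := None :: [seq Some x | x <- enum D ++ enum D'].
have card2 : (#|D| <= 2)%N by case: adj => // card1 _ _;
  exact: leq_trans card1 _.
have size_r : (size r <= 6)%N.
  have cD : #|D'| = #|D| by apply: card_setDC; rewrite cs cs'.
  rewrite /= size_map size_cat -!cardE cD.
  by rewrite ltnS (leq_trans (leq_add card2 card2)).
have noner : None \in r by rewrite in_cons eqxx.
have rD x : x \in s.1 -> x \notin s'.1 -> Some x \in r.
  move=> xs xs'; rewrite in_cons /= mem_map; last exact: Some_inj.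
  by rewrite mem_cat !mem_enum !inE xs xs'.
have rD' x : x \notin s.1 -> x \in s'.1 -> Some x \in r.
  move=> xs xs'; rewrite in_cons /= mem_map; last exact: Some_inj.
  by rewrite mem_cat !mem_enum !inE xs xs' orbT.
case: adj => [_ cT' cN|i _ iT ci cj _]; split.
- apply: (dp_of_shift (r := r) (j := None) (a := -1)) => // [|n nr].
    by rewrite normrN normr1.
  apply: noisy_output_eq => x; rewrite noisy_count_shift_shared /noisy_count.
  case: (boolP (x \in s.1)) => xs; case: (boolP (x \in s'.1)) => xs'.
  + by left; split => //; rewrite cT'// -natr1 addrK.
  + right; split => // _.
    by rewrite cN//; apply: lt_threshold; rewrite ?ler01 ?nr ?rD.
  + right; split => // _; rewrite cT'// c0//.
    by apply: lt_threshold; rewrite ?subrr ?ler01 ?nr ?rD'.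
  + by right; split.
- apply: (dp_of_shift (r := r) (j := None) (a := 1)) => // [|n nr].
    by rewrite normr1.
  apply: noisy_output_eq => x; rewrite noisy_count_shift_shared /noisy_count.
  case: (boolP (x \in s'.1)) => xs'; case: (boolP (x \in s.1)) => xs.
  + by left; split => //; rewrite cT'// -natr1.
  + right; split => // _; rewrite cT'// c0//.
    by apply: lt_threshold; rewrite ?nr ?rD'.
  + right; split => // _.
    by rewrite cN//; apply: lt_threshold; rewrite ?add0r ?nr ?rD.
  + by right; split.
- apply: (dp_of_shift (r := r) (j := Some i) (a := 1)) => // [|n nr].
    by rewrite normr1.
  apply: noisy_output_eq => x; rewrite noisy_count_shift_key /noisy_count.
  case: (boolP (x \in s.1)) => xs; case: (boolP (x \in s'.1)) => xs'.
  + left; split => //; case: (eqVneq x i) => [->|xi];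
      first by rewrite ci -natr1.
    by rewrite addr0 cj.
  + right; split => // _; apply: lt_threshold; rewrite ?nr ?rD//.
    case: (eqVneq x i) => [xi|xi]; last by rewrite cj// c0' ?ler01.
    by rewrite xi ci c0' -?xi.
  + right; split => // _; have xi : x != i by apply: contraNneq xs => ->.
    by rewrite (negPf xi) -cj// c0//; apply: lt_threshold;
      rewrite ?addr0 ?ler01 ?nr ?rD'.
  + by right; split.
- apply: (dp_of_shift (r := r) (j := Some i) (a := -1)) => // [|n nr].
    by rewrite normrN normr1.
  apply: noisy_output_eq => x; rewrite noisy_count_shift_key /noisy_count.
  case: (boolP (x \in s'.1)) => xs'; case: (boolP (x \in s.1)) => xs.
  + left; split => //; case: (eqVneq x i) => [->|xi];
      first by rewrite ci -natr1 addrK.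
    by rewrite addr0 cj.
  + right; split => // _; have xi : x != i by apply: contraNneq xs => ->.
    by rewrite -cj// c0//; apply: lt_threshold; rewrite ?ler01 ?nr ?rD'.
  + right; split => // _; apply: lt_threshold; rewrite ?nr ?rD//.
    case: (eqVneq x i) => [xi|xi]; last by rewrite cj// c0' ?addr0 ?ler01.
    by rewrite xi ci c0' -?xi// subrr ler01.
  + by right; split.
Qed.

Lemma dp_neighboring (S S' : seq 'I_d) (Z : set (sketch d k R)) :
  neighboring S S' -> <<s G >> Z ->
  (P [set w | Z (out (mg k S) (fun i => N i w))] <=
   (expR eps)%:E * P [set w | Z (out (mg k S') (fun i => N i w))] + delta%:E)%E.
Proof.
move=> [A [B [u [[-> ->]|[-> ->]]]]] GZ.
all: have [] // := dp_adjacent (well_formed_mg k (A ++ u :: B))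
  (well_formed_mg k (A ++ B)) (mg_adjacent_delete k A B u) GZ.
Qed.

End Privacy.

(** * Accuracy *)

Section Memory.
Variables d k : nat.
Local Open Scope nat_scope.

Lemma size_words (V : Type) (s : sketch d k V) : size (words s) = 2 * #|s.1|.
Proof. by rewrite size_cat !size_map -!cardE addnn mul2n. Qed.

Lemma max_words_scanl (s : sketch d k nat) (S : seq 'I_d) : well_formed s ->
  \max_(s' <- scanl (@mg_step d k) s S) size (words s') <= 2 * k.
Proof.
elim: S s => [|u S IH] s ws /=; first by rewrite big_nil.
have ws' := well_formed_step u ws.
by rewrite big_cons geq_max IH// size_words (proj1 ws') leqnn.
Qed.

End Memory.

Section Accuracy.
Context {R : realType} {dsp : measure_display} {Omega : measurableType dsp}.
Context {P : probability Omega R}.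
Variables (d k : nat) (eps delta : R) (S : seq 'I_d).
Local Notation key := ('I_(d + k)).
Hypotheses (eps_gt0 : 0 < eps) (delta_gt0 : 0 < delta) (delta_le1 : delta <= 1).
Local Notation thr := (threshold eps delta).
Local Notation s := (mg k S).
Local Notation fhat := (fun n x => estimate (noisy_output eps delta s n) x).
Local Notation f := (fun x : 'I_d => (count_mem x S)%:R : R).
Local Notation err := ((size S)%:R / k.+1%:R : R).

Lemma estimate_noisyE (n : option key -> R) x :
  fhat n x = (noisy_output eps delta s n).2 (lshift k x).
Proof.
by rewrite /estimate mem_noisy_output noisy_outputE; case: (_ && _).
Qed.

(** The balance in [mg_error] gives [k.+1 * m <= size S]. *)
Lemma mg_error_le x :
  (s.2 (lshift k x))%:R <= f x <= (s.2 (lshift k x))%:R + err.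
Proof.
have [m [sumE cE]] := mg_error k S; have /andP[cl cu] := cE x.
rewrite ler_nat cl/= (@le_trans _ _ ((s.2 (lshift k x))%:R + m%:R))//.
  by rewrite -natrD ler_nat.
by rewrite lerD2l ler_pdivlMr ?ltr0n// -natrM ler_nat mulnC -sumE leq_addl.
Qed.

(** From [ln y <= y - 1] at [y = delta / 3 <= 1 / 3]. The value 1 / 2 is what makes the threshold at
    least [1 / eps]. *)
Lemma ln3_ge : 1 / 2 <= ln (3 / delta).
Proof.
have : ln (delta / 3) <= delta / 3 - 1.
  have := @le_ln1Dx R (delta / 3 - 1); rewrite [1 + _]addrC subrK; apply.
  by rewrite -subr_gt0 opprK subrK divr_gt0.
have -> : delta / 3 = (3 / delta)^-1 by rewrite invf_div.
rewrite lnV ?posrE ?divr_gt0// invf_div.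
by move: delta_le1; lra.
Qed.

Lemma threshold_ge : 1 / eps <= thr.
Proof.
have e0 : 0 < eps^-1 by rewrite invr_gt0.
by rewrite /threshold; have := ln3_ge; rewrite -(ler_pM2r e0); lra.
Qed.

Lemma threshold_ge0 : 0 <= thr.
Proof. by apply: le_trans threshold_ge; rewrite divr_ge0// ltW. Qed.

(** Three errors add up: the noise, the Misra-Gries loss, and a count below [thr] replaced by 0.
    Noise matters only at stored keys, which later keeps the union bound at [k.+1] noises. *)
Lemma estimate_bounds (n : option key -> R) (v : R) (x : 'I_d) :
  0 <= v -> (lshift k x \in s.1 -> `|n None + n (Some (lshift k x))| <= v) ->
  f x - v - thr - err <= fhat n x <= f x + v.
Proof.
move=> v0 nv; have /andP[cl cu] := mg_error_le x.
have f0 : 0 <= f x by []. have t0 := threshold_ge0.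
have e0 : 0 <= err by rewrite divr_ge0.
rewrite estimate_noisyE noisy_outputE /noisy_count.
case: (boolP (lshift k x \in s.1)) => /= xs; last first.
  move: cl cu; rewrite (proj2 (well_formed_mg k S))//;
    move: (f x) err f0 e0 => a b; lra.
have {nv} := nv xs; rewrite ler_norml => /andP[nl nu].
have c0 : 0 <= (s.2 (lshift k x))%:R :> R by [].
move: (f x) err (s.2 _)%:R f0 e0 cl cu c0 => a b c f0 e0 cl cu c0.
by case: (leP thr) => h; lra.
Qed.

Variable N : option key -> {RV P >-> R}.
Hypothesis lapN : forall i, laplace_distributed eps^-1 (N i).

Lemma measurable_estimate x :
  measurable_fun [set: Omega] (fun w => fhat (fun i => N i w) x).
Proof.
under eq_fun do rewrite estimate_noisyE.
exact: (measurable_noisy_output2 eps delta s (n := fun i w => N i w)).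
Qed.

Lemma estimate_accuracy (beta : R) : 0 < beta -> beta < 1 ->
  ((1 - beta)%:E <= P [set w | forall x : 'I_d,
     (f x - 2 * ln (k.+1%:R / beta) / eps - 1 - 2 * ln (3 / delta) / eps - err
      <= fhat (fun i => N i w) x <= f x + 2 * ln (k.+1%:R / beta) / eps)%R])%E.
Proof.
move=> b0 b1; set target := [set w | _].
have kb : 0 < k.+1%:R / beta by rewrite divr_gt0.
pose b := ln (k.+1%:R / beta) / eps.
have bge0 : 0 <= b.
  rewrite divr_ge0 ?(ltW eps_gt0)// ln_ge0// ler_pdivlMr// mul1r.
  by rewrite (le_trans (ltW b1))// ler1n.
have mtarget : measurable target.
  have -> : target = \bigcap_(x in [set: 'I_d])
    ([set w | f x - 2 * ln (k.+1%:R / beta) / eps - 1 - 2 * ln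
      (3 / delta) / eps - err
      <= fhat (fun i => N i w) x] `&`
     [set w | fhat (fun i => N i w) x <= f x + 2 * ln (k.+1%:R / beta) / eps]).
    apply/seteqP; split => [w tw x _|w tw x]; first exact/andP/(tw x).
    exact/andP/(tw x Logic.I).
  apply: fin_bigcap_measurable => [|x _]; first exact: finite_finset.
  by apply: measurableI; apply: measurable_set_le => //;
    exact: measurable_estimate.
(* The stored keys depend on the stream alone, so these are [k.+1] noises fixed in advance, each
   above [b] in absolute value with probability at most [beta / k.+1]. *)
pose r : seq (option key) := None :: [seq Some x | x <- enum s.1].
pose bad := \big[setU/set0]_(i <- r) [set w | b < `|N i w|].
have mb i : measurable [set w | b < `|N i w|].
  by apply: measurable_set_lt => //; exact: measurableT_comp.
have mbad : measurable bad by exact: bigsetU_measurable.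
have Pbad : (P bad <= beta%:E)%E.
  have tail i : (P [set w | b < `|N i w|]%R <= (beta / k.+1%:R)%:E)%E.
    apply: (le_trans (laplace_abs_tail eps_gt0 (lapN i) bge0)).
    rewrite lee_fin /b mulrCA divff ?gt_eqF// mulr1 expRN lnK ?posrE//.
    by rewrite invf_div.
  apply: (le_trans (measure_bigsetU_le r mb tail)).
  rewrite lee_fin /= size_map -cardE (proj1 (well_formed_mg k S)).
  by rewrite mulrCA divff ?mulr1// pnatr_eq0.
apply: (@le_trans _ _ (P (~` bad))).
  by rewrite probability_setC// EFinB leeB.
apply: le_measure; rewrite ?inE//; first exact: measurableC.
move=> w wgood x.
have good i : i \in r -> `|N i w| <= b.
  move=> ir; rewrite leNgt; apply/negP => bi; apply: wgood.
  by rewrite /bad big_seq -bigcup_seq_cond; exists i => //=; rewrite ir.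
have := @estimate_bounds (fun i => N i w) (2 * b) x.
rewrite mulr_ge0// => /(_ isT); rewrite /threshold /b !mulrA => H.
have {}H : f x - 2 * ln (k.+1%:R / beta) / eps - (1 + 2 * ln
  (3 / delta) / eps) - err
  <= fhat (fun i => N i w) x <= f x + 2 * ln (k.+1%:R / beta) / eps.
  apply: H => xs; apply: (le_trans (ler_normD _ _)).
  have g0 : `|N None w| <= b by apply: good; rewrite in_cons eqxx.
  have g1 : `|N (Some (lshift k x)) w| <= b.
    by apply: good; rewrite in_cons /= mem_map ?mem_enum//; exact: Some_inj.
  by have := lerD g0 g1; rewrite /b; lra.
by move: H; rewrite opprD addrA.
Qed.

Lemma estimate_sqr_error (n : option key -> R) (x : 'I_d) :
  (fhat n x - f x) ^+ 2 <= 3 * (err ^+ 2 + thr ^+ 2)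
    + (6 * n None ^+ 2 + 6 * n (Some (lshift k x)) ^+ 2).
Proof.
set y := n None; set z := n (Some _).
have /andP[] := @estimate_bounds n `|y + z| x (normr_ge0 _) (fun=> lexx _).
have t0 := threshold_ge0.
have e0 : 0 <= err by rewrite divr_ge0.
have : `|y + z| ^+ 2 = (y + z) ^+ 2 by rewrite real_normK// num_real.
move: `|y + z| (normr_ge0 (y + z)) thr t0 err e0 => v v0 u u0 e e0 vE.
move: (fhat n x) (f x) => p q pl pu.
have le1 : (p - q) ^+ 2 <= (v + u + e) ^+ 2.
  rewrite -ler_sqrt ?sqr_ge0// !sqrtr_sqr [`|v + u + e|]ger0_norm; last lra.
  by rewrite ler_norml; lra.
apply: (le_trans le1).
(* These squares give [(v + u + e) ^+ 2 <= 3 * (v ^+ 2 + u ^+ 2 + e ^+ 2)] and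
   [(y + z) ^+ 2 <= 2 * y ^+ 2 + 2 * z ^+ 2]. *)
have s1 := sqr_ge0 (v - u); have s2 := sqr_ge0 (v - e).
have s3 := sqr_ge0 (u - e); have s4 := sqr_ge0 (y - z).
nra.
Qed.

Lemma estimate_mse x :
  ('E_P[fun w => ((fhat (fun i => N i w) x - f x) ^+ 2)%R] <=
   (3 * (1 + (2 + 2 * ln (3 / delta)) / eps + err) ^+ 2)%:E)%E.
Proof.
have msq i : measurable_fun [set: Omega] (fun w => (N i w ^+ 2)%:E).
  by apply/measurable_EFinP; exact: measurable_funX.
have sq0 i w : (0 <= (N i w ^+ 2)%:E)%E by rewrite lee_fin sqr_ge0.
have K0 : 0 <= 3 *
  (err ^+ 2 + thr ^+ 2) by rewrite mulr_ge0// addr_ge0// sqr_ge0.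
rewrite unlock.
apply: (@le_trans _ _ (\int[P]_w ((3 * (err ^+ 2 + thr ^+ 2))%:E
   + (6%:E * (N None w ^+ 2)%:E + 6%:E * (N (Some
       (lshift k x)) w ^+ 2)%:E)))%E).
  apply: ge0_le_integral => //.
  - by move=> w _; rewrite lee_fin sqr_ge0.
  - apply/measurable_EFinP; apply: measurable_funX;
      apply: measurable_funB => //.
    exact: measurable_estimate.
  - by apply: emeasurable_funD => //; apply: emeasurable_funD;
      exact: measurable_funeM.
  - move=> w _; rewrite -!EFinM -!EFinD lee_fin.
    exact: estimate_sqr_error.
rewrite ge0_integralD//; last 2 first.
- by move=> w _; rewrite adde_ge0// mule_ge0.
- by apply: emeasurable_funD; exact: measurable_funeM.
rewrite integral_cst//= probability_setT mule1.
rewrite ge0_integralD//; last 4 first.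
- by move=> w _; rewrite mule_ge0.
- exact: measurable_funeM.
- by move=> w _; rewrite mule_ge0.
- exact: measurable_funeM.
rewrite !ge0_integralZl_EFin//.
have m2 i : (\int[P]_w (N i w ^+ 2)%:E = (2 / eps ^+ 2)%:E)%E.
  by rewrite -(laplace_second_moment eps_gt0 (lapN i)) unlock.
rewrite !m2 -!EFinM -!EFinD lee_fin.
have e0 : 0 <= err by rewrite divr_ge0.
have te := threshold_ge; have ie : 0 < eps^-1 by rewrite invr_gt0.
have -> : 1 + (2 + 2 * ln (3 / delta)) / eps + err = thr + 2 * eps^-1 + err.
  by rewrite /threshold; ring.
(* The noise contributes [24 * i ^+ 2], with [i] for [1 / eps]. Expanding [3 * (u + 2 * i + e) ^+ 2]
   provides [12 * i ^+ 2 + 12 * u * i], which suffices since [u] is at least [i]. *)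
rewrite -exprVn; move: thr err eps^-1 te e0 ie => u e i;
  rewrite mul1r => te e0 ie.
nra.
Qed.

End Accuracy.

(** In the accuracy clauses [delta <= 1] keeps the threshold nonnegative; a very negative threshold
    could push the lower bound above an estimate equal to 0. *)
Theorem theorem5p8 (R : realType) (dsp : measure_display)
    (Omega : measurableType dsp) (P : probability Omega R)
    (d k : nat) (eps delta : R)
    (eta : {RV P >-> R}) (L : 'I_(d + k) -> {RV P >-> R}) (S : seq 'I_d)
    (k_gt0 : (0 < k)%N) (eps_gt0 : 0 < eps) (delta_gt0 : 0 < delta)
    (noise : laplace_noise eps^-1 eta L) :
  let PMG := pmg eps delta eta L in
  let f := fun x : 'I_d => (count_mem x S)%:R : R in
  let fhat := fun (x : 'I_d) (w : Omega) => estimate (PMG S w) x in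
  let lower := fun (beta : R) (x : 'I_d) =>
    f x - 2 * ln (k.+1%:R / beta) / eps - 1 - 2 * ln (3 / delta) / eps
      - (size S)%:R / k.+1%:R in
  let upper := fun (beta : R) (x : 'I_d) =>
    f x + 2 * ln (k.+1%:R / beta) / eps in
  differentially_private P (@output_generators R d k) PMG eps delta /\
  (forall x, f x = 0 -> forall w, fhat x w = 0) /\
  (delta <= 1 -> forall beta : R, 0 < beta -> beta < 1 ->
    ((1 - beta)%:E <=
     P [set w | forall x : 'I_d,
          (lower beta x <= fhat x w <= upper beta x)%R])%E) /\
  (forall w,
    (forall x, 0 < fhat x w -> lshift k x \in (PMG S w).1) /\
    (#|[set x | (0 < fhat x w)%R]%SET| <= k)%N) /\
  (delta <= 1 -> forall x : 'I_d,
    ('E_P[fun w => ((fhat x w - f x) ^+ 2)%R] <=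
     (3 * (1 + (2 + 2 * ln (3 / delta)) / eps
             + (size S)%:R / k.+1%:R) ^+ 2)%:E)%E) /\
  (forall w, pmg_memory eps delta eta L S w = (2 * k)%N).
Proof.
move=> PMG f fhat lower upper.
case: noise; set N := fun i : option _ => _ => lapN indN.
have [wk _] := well_formed_mg k S.
have fhat_gt0 x w : 0 < fhat x w -> lshift k x \in (PMG S w).1.
  by rewrite /fhat /estimate; case: ifP => //; rewrite ltxx.
have PMG_sub w x : x \in (PMG S w).1 -> x \in (mg k S).1.
  by rewrite inE => /andP[].
split.
  (* For [delta] above 1 privacy is trivial, probabilities being at most 1. *)
  move=> S1 S2 S12 Z GZ; case: (leP delta 1) => d1.
    exact: (dp_neighboring eps_gt0 delta_gt0 d1 lapN indN S12 GZ).
  have mM : measurable (PMG S1 @^-1` Z).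
    exact: (measurable_noisy_output eps delta (mg k S1) (n := fun i w =>
      N i w)).
  apply: (le_trans (probability_le1 P mM)).
  apply: (@le_trans _ _ delta%:E); first by rewrite lee_fin ltW.
  by rewrite leeDr// mule_ge0// lee_fin expR_ge0.
split.
  move=> x /eqP; rewrite pnatr_eq0 => fx w; apply/eqP/negPn/negP => fh.
  have : lshift k x \in (PMG S w).1.
    by apply: contraNT fh; rewrite /fhat /estimate => /negPf ->.
  by move/PMG_sub/mem_mg; rewrite -has_pred1 has_count (eqP fx).
split.
  by move=> d1 beta b0 b1;
    exact: (estimate_accuracy S eps_gt0 delta_gt0 d1 (N := N) lapN).
split.
  move=> w; split; first by move=> x; exact: fhat_gt0.
  rewrite -[leqRHS]wk -(card_imset _ (@lshift_inj d k)); apply: subset_leq_card.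
  apply/fintype.subsetP => _ /imsetP[x + ->]; rewrite inE => /fhat_gt0.
  exact: PMG_sub.
split.
  by move=> d1 x; exact: (estimate_mse S eps_gt0 delta_gt0 d1 (N := N) lapN x).
move=> w; rewrite /pmg_memory; apply/eqP; rewrite eqn_leq; apply/andP; split.
  rewrite !geq_max !size_words /= wk leqnn /= big_cons geq_max size_words.
  rewrite (proj1 (well_formed_init d k)) leqnn max_words_scanl//=;
    last exact: well_formed_init.
  rewrite leq_mul2l /= -[leqRHS]wk; apply: subset_leq_card.
  by apply/fintype.subsetP => x; exact: (PMG_sub w).
(* The bound is attained by the noisy sketch, which still holds all [k] keys. *)
rewrite leq_max; apply/orP; right; rewrite leq_max; apply/orP; left.
by rewrite size_words /= wk.
Qed.
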